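(* Let $\mathrm{WGr}(d,n)$ be a weighted Grassmann orbifold corresponding to $W=(w_1,\dots,w_n)\in(\mathbb{Z}_{\ge0})^n$ and $a\ge1$. Then there is a $(\mathbb{C}^* )^n$-invariant stratification $$\{pt\}=X_0\subset X_1\subset X_2\subset\cdots\subset X_m=\mathrm{WGr}(d,n)$$ such that for $i=1,\dots,m$ the quotient $X_i/X_{i-1}$ is homeomorphic to the Thom space $Th(\xi^i)$ of an orbifold $(\mathbb{C}^* )^n$-vector bundle $$\xi^i:\mathbb{C}^{\ell(\lambda^i)}/G(c_i)\to[C(\lambda^i)],$$ where $G(c_i)$ is the cyclic group of $c_i$-th roots of unity.
   Context: Fix integers $1\le d<n$, $W=(w_1,\dots,w_n)\in(\mathbb{Z}_{\ge 0})^n$ and an integer $a\ge 1$. Let $M_d(n,d)$ be the set of complex $n\times d$ matrices of rank $d$. For $A,B\in M_d(n,d)$ write $A\sim_w B$ if $B=\mathrm{diag}(t^{w_1},\dots,t^{w_n})\,A\,T$ for some $T\in \mathrm{GL}(d,\mathbb{C})$ and $t\in\mathbb{C}^*$ with $t^a=\det(T)$. The weighted Grassmann orbifold is $\mathrm{WGr}(d,n):=M_d(n,d)/\!\sim_w$ with the quotient topology; $(\mathbb{C}^* )^n$ acts on it by $(t_1,\dots,t_n)\cdot[A]=[\mathrm{diag}(t_1,\dots,t_n)A]$. A Schubert symbol for $d<n$ is a sequence of integers $\lambda=(\lambda_1,\dots,\lambda_d)$ with $1\le\lambda_1<\cdots<\lambda_d\le n$; its length is $\ell(\lambda)=\sum_{j=1}^d(\lambda_j-j)$;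 $\lambda\preceq\mu$ if $\lambda_j\le\mu_j$ for all $j$. Put $m:=\binom{n}{d}-1$ and fix a total order $\lambda^0<\cdots<\lambda^m$ on Schubert symbols preserving $\preceq$. Put $c_i:=a+\sum_{j=1}^d w_{\lambda^i_j}$. $C(\lambda)\in M_d(n,d)$ is the matrix with columns $e_{\lambda_1},\dots,e_{\lambda_d}$ (standard basis vectors of $\mathbb{C}^n$); $[C(\lambda)]$ is a fixed point of the action. An orbifold $(\mathbb{C}^* )^n$-vector bundle over a point is the quotient of a complex vector space by a linear action of a finite group, together with a compatible $(\mathbb{C}^* )^n$-action; its Thom space is the one-point compactification of its total space. *)

(* Defs.v *)
From mathcomp Require Import all_boot all_order all_algebra.
From mathcomp Require Import all_classical all_reals topology normedtype.
From mathcomp Require Import complex.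

Set Implicit Arguments.
Unset Strict Implicit.
Unset Printing Implicit Defensive.

Import Order.TTheory GRing.Theory Num.Theory.
Import numFieldNormedType.Exports.

Local Open Scope classical_set_scope.
Local Open Scope ring_scope.
Local Open Scope quotient_scope.

(* Packaging R[i] as a numClosedFieldType lets its sort inherit the topology
   that numFieldNormedType puts on every numFieldType (the one given by the
   modulus); the inductive type R[i] itself carries none. *)
Definition Cplx (R : realType) : numClosedFieldType := R[i].

Definition homeomorphism (X Y : topologicalType) (f : X -> Y) : Prop :=
  continuous f /\ exists g : Y -> X, [/\ continuous g, cancel f g & cancel g f].

Section Collapse.
Context {T : topologicalType} (A : set T).

Definition collapse_rel : rel T :=
  fun x y => (x == y) || (x \in A) && (y \in A).

Lemma collapse_refl : reflexive collapse_rel.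
Proof. by move=> x; rewrite /collapse_rel eqxx. Qed.

Lemma collapse_sym : symmetric collapse_rel.
Proof. by move=> x y; rewrite /collapse_rel eq_sym andbC. Qed.

Lemma collapse_trans : transitive collapse_rel.
Proof.
move=> y x z; rewrite /collapse_rel.
case/orP => [/eqP-> //|/andP[xA yA]]; case/orP => [/eqP<-|/andP[_ zA]].
  by rewrite xA yA orbT.
by rewrite xA zA orbT.
Qed.

Canonical collapse_equiv :=
  EquivRel collapse_rel collapse_refl collapse_sym collapse_trans.

(* The quotient space T / A. *)
Definition collapse := quotient_topology {eq_quot collapse_equiv}.

End Collapse.

Section Torus.
Variables (R : realType) (n : nat).
Local Notation C := (Cplx R).

Definition torus_set : set 'rV[C]_n := [set t | forall i, t 0 i != 0].

(* The torus (C^* )^n, with its subspace topology. *)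
Definition torus : Type := set_type torus_set.

Lemma torusP (t : torus) i : \val t 0 i != 0.
Proof. by case: t => t /= /set_mem. Qed.

Lemma torus_one_subproof : const_mx 1 \in torus_set.
Proof. by apply/mem_set => i; rewrite mxE oner_neq0. Qed.

Definition torus_one : torus := exist (fun t => t \in torus_set) _ torus_one_subproof.

Lemma torus_mul_subproof (s t : torus) :
  map2_mx *%R (\val s) (\val t) \in torus_set.
Proof. by apply/mem_set => i; rewrite mxE mulf_neq0 ?torusP. Qed.

Definition torus_mul (s t : torus) : torus := 
  exist (fun t => t \in torus_set) _ (torus_mul_subproof s t).

End Torus.

Section Schubert.
Variables (d n : nat).

(* Positions and entries are 0-based: lambda_j is (l (j - 1)).+1. *)
Definition schubert_symbol :=
  {l : {ffun 'I_d -> 'I_n} | [forall i : 'I_d, forall j : 'I_d, (i < j)%N ==> (l i < l j)%N]}.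

Definition schubert_val (l : schubert_symbol) : 'I_d -> 'I_n := \val l.

(* The truncated subtraction is exact, since j <= l_j for a Schubert symbol;
   the 0-based shifts of l_j and j cancel. *)
Definition schubert_length (l : schubert_symbol) : nat :=
  (\sum_(j < d) (schubert_val l j - j))%N.

Definition schubert_le (l m : schubert_symbol) : Prop :=
  forall j, (schubert_val l j <= schubert_val m j)%N.

Lemma schubert_lt (l : schubert_symbol) (i j : 'I_d) :
  (i < j)%N -> (schubert_val l i < schubert_val l j)%N.
Proof. by move=> ij; have /forallP/(_ i)/forallP/(_ j)/implyP := valP l; apply. Qed.

Lemma schubert_inj (l : schubert_symbol) : injective (schubert_val l).
Proof.
move=> i j e; apply/val_inj/eqP; case: ltngtP => // /(schubert_lt l).
all: by rewrite e ltnn.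
Qed.

End Schubert.

Section WeightedGrassmann.
Variables (R : realType) (n d : nat).
Local Notation C := (Cplx R).

(* M_d(n, d), with the subspace topology. *)
Definition frame_set : set 'M[C]_(n, d) := [set A | \rank A = d].

Definition frame : Type := set_type frame_set.

Lemma frameP (A : frame) : \rank (\val A) = d.
Proof. by case: A => A /= /set_mem. Qed.

Lemma row_full_diag (t : torus R n) : row_full (diag_mx (\val t)).
Proof.
rewrite row_full_unit unitmxE det_diag unitfE.
by apply/prodf_neq0 => i _; rewrite torusP.
Qed.

Lemma scale_frame_subproof (t : torus R n) (A : frame) :
  diag_mx (\val t) *m \val A \in frame_set.
Proof.
by apply/mem_set; rewrite /frame_set /= (eqmxMfull _ (row_full_diag t)) frameP.
Qed.

Definition scale_frame (t : torus R n) (A : frame) : frame :=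
  exist (fun A => A \in frame_set) _ (scale_frame_subproof t A).

Definition schubert_mx (l : schubert_symbol d n) : 'M[C]_(n, d) :=
  \matrix_(i, j) (i == schubert_val l j)%:R.

Lemma schubert_mx_subproof l :
  schubert_mx l \in frame_set.
Proof.
apply/mem_set; rewrite /frame_set /=; apply/eqP; rewrite eqn_leq rank_leq_col /=.
have e : \rank ((schubert_mx l)^T *m schubert_mx l) = d.
  rewrite (_ : _ *m _ = 1%:M) ?mxrank1 //; apply/matrixP => i j.
  rewrite !mxE (bigD1 (schubert_val l i)) //= !mxE eqxx mul1r.
  rewrite big1 ?addr0 => [|k /negPf ki]; last by rewrite !mxE ki mul0r.
  by rewrite (inj_eq (@schubert_inj _ _ l)).
by rewrite -[leqLHS]e; exact: mxrankM_maxr.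
Qed.

Definition schubert_frame (l : schubert_symbol d n) : frame :=
  exist (fun A => A \in frame_set) _ (schubert_mx_subproof l).

Variables (w : 'I_n -> nat) (a : nat).

Definition weight_mx (t : C) : 'M[C]_n := diag_mx (\row_i t ^+ w i).

Definition wrel_prop (A B : frame) : Prop :=
  exists (t : C) (T : 'M[C]_d), [/\ t != 0, T \in unitmx, t ^+ a = \det T
    & \val B = weight_mx t *m \val A *m T].

Definition wrel : rel frame := fun A B => `[< wrel_prop A B >].

Lemma weight_mx1 : weight_mx 1 = 1%:M.
Proof.
rewrite /weight_mx -diag_const_mx; congr diag_mx.
by apply/rowP => i; rewrite !mxE expr1n.
Qed.

Lemma weight_mxM s t : weight_mx (s * t) = weight_mx s *m weight_mx t.
Proof.
rewrite /weight_mx mulmx_diag; congr diag_mx.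
by apply/rowP => i; rewrite !mxE exprMn.
Qed.

Lemma weight_mx_diagC t (u : 'rV[C]_n) :
  weight_mx t *m diag_mx u = diag_mx u *m weight_mx t.
Proof.
by rewrite /weight_mx !mulmx_diag; congr diag_mx; apply/rowP => i; rewrite !mxE mulrC.
Qed.

Lemma wrel_refl : reflexive wrel.
Proof.
move=> A; apply/asboolP; exists 1, 1%:M.
by rewrite oner_neq0 unitmx1 expr1n det1 weight_mx1 mul1mx mulmx1.
Qed.

Lemma wrel_symW A B : wrel A B -> wrel B A.
Proof.
move=> /asboolP[t [T [t0 uT tT eB]]]; apply/asboolP; exists t^-1, (invmx T).
split; [by rewrite invr_eq0|by rewrite unitmx_inv|by rewrite exprVn tT det_inv|].
by rewrite eB !mulmxA -weight_mxM mulVf // weight_mx1 mul1mx -mulmxA mulmxV // mulmx1.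
Qed.

Lemma wrel_sym : symmetric wrel.
Proof. by move=> A B; apply/idP/idP => /wrel_symW. Qed.

Lemma wrel_trans : transitive wrel.
Proof.
move=> B A D /asboolP[t [T [t0 uT tT eB]]] /asboolP[s [S [s0 uS sS eD]]].
apply/asboolP; exists (s * t), (T *m S); split.
- by rewrite mulf_neq0.
- by rewrite unitmx_mul uT uS.
- by rewrite exprMn tT sS det_mulmx mulrC.
- by rewrite eD eB weight_mxM !mulmxA.
Qed.

Canonical wrel_equiv := EquivRel wrel wrel_refl wrel_sym wrel_trans.

Definition WGr := quotient_topology {eq_quot wrel_equiv}.

Definition WGr_act (t : torus R n) (x : WGr) : WGr :=
  \pi_WGr (scale_frame t (repr x)).

Lemma WGr_actE t (A : frame) :
  WGr_act t (\pi_WGr A) = \pi_WGr (scale_frame t A).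
Proof.
apply/eqmodP => /=; apply: wrel_symW.
have : wrel A (repr (\pi_WGr A)) by apply/eqmodP; rewrite reprK.
move=> /asboolP[s [S [s0 uS sS e]]]; apply/asboolP; exists s, S; split => //=.
by rewrite e !mulmxA weight_mx_diagC.
Qed.

Definition schubert_point (l : schubert_symbol d n) : WGr :=
  \pi_WGr (schubert_frame l).

Definition schubert_weight (l : schubert_symbol d n) : nat :=
  (a + \sum_(j < d) w (schubert_val l j))%N.

End WeightedGrassmann.

Section OrbifoldBundle.
Variable R : realType.
Local Notation C := (Cplx R).

(* The group of c-th roots of unity, for 0 < c; asking that z be nonzero
   excludes nothing then, and makes this a group for every c. *)
Definition unity_group (c : nat) : set C := [set z | z != 0 /\ z ^+ c = 1].

Record linear_action (c l : nat) := LinearAction {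
  action_mx :> C -> 'M[C]_l;
  action_mx1 : action_mx 1 = 1%:M;
  action_mxM : {in unity_group c &, forall y z,
    action_mx (y * z) = action_mx y *m action_mx z} }.

Section OrbitSpace.
Variables (c l : nat) (rho : linear_action c l).

Definition orbit_rel : rel 'cV[C]_l :=
  fun u v => `[< exists2 z, unity_group c z & v = rho z *m u >].

Lemma unity_group1 : unity_group c 1.
Proof. by split; rewrite ?oner_neq0 ?expr1n. Qed.

Lemma unity_groupM y z :
  unity_group c y -> unity_group c z -> unity_group c (y * z).
Proof. by move=> [y0 yc] [z0 zc]; split; rewrite ?mulf_neq0 // exprMn yc zc mulr1. Qed.

Lemma unity_groupV z : unity_group c z -> unity_group c z^-1.
Proof. by move=> [z0 zc]; split; rewrite ?invr_eq0 // exprVn zc invr1. Qed.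

Lemma orbit_refl : reflexive orbit_rel.
Proof.
move=> u; apply/asboolP; exists 1; first exact: unity_group1.
by rewrite action_mx1 mul1mx.
Qed.

Lemma orbit_symW u v : orbit_rel u v -> orbit_rel v u.
Proof.
move=> /asboolP[z Gz ->]; have GzV := unity_groupV Gz.
apply/asboolP; exists z^-1 => //.
rewrite mulmxA -action_mxM ?mem_setE; try exact/mem_set.
by case: Gz => z0 _; rewrite mulVf // action_mx1 mul1mx.
Qed.

Lemma orbit_sym : symmetric orbit_rel.
Proof. by move=> u v; apply/idP/idP => /orbit_symW. Qed.

Lemma orbit_trans : transitive orbit_rel.
Proof.
move=> v u x /asboolP[y Gy ->] /asboolP[z Gz ->].
apply/asboolP; exists (z * y); first exact: unity_groupM.
by rewrite action_mxM ?mulmxA //; exact/mem_set.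
Qed.

Canonical orbit_equiv := EquivRel orbit_rel orbit_refl orbit_sym orbit_trans.

(* The total space C^l / G(c). *)
Definition orbit_space := quotient_topology {eq_quot orbit_equiv}.

End OrbitSpace.

(* An orbifold (C^* )^n-vector bundle C^l / G(c) over a point.  The torus acts
   continuously on the total space, and each of its elements acts by a map that
   lifts to a linear map of C^l.  The lifts need not form an action of the torus
   itself: in general they only give one of a finite cover of it. *)
Record orbibundle (n c l : nat) := Orbibundle {
  bundle_rep : linear_action c l;
  bundle_act : torus R n -> orbit_space bundle_rep -> orbit_space bundle_rep;
  bundle_act1 : forall x, bundle_act (torus_one R n) x = x;
  bundle_actM : forall s t x,
    bundle_act (torus_mul s t) x = bundle_act s (bundle_act t x);
  bundle_act_continuous : continuous
    (fun p : torus R n * orbit_space bundle_rep => bundle_act p.1 p.2);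
  bundle_act_linear : forall t, exists M : 'M[C]_l, forall v : 'cV[C]_l,
    bundle_act t (\pi_(orbit_space bundle_rep) v) =
    \pi_(orbit_space bundle_rep) (M *m v) }.

Variables (n c l : nat) (xi : orbibundle n c l).

Definition total_space := orbit_space (bundle_rep xi).

Definition zero_section : total_space := \pi_total_space 0.

Definition thom := one_point_compactification total_space.

(* The induced action fixes the point at infinity. *)
Definition thom_act (t : torus R n) : thom -> thom := omap (@bundle_act _ _ _ xi t).

End OrbifoldBundle.

(* Main.v *)
(* Write p_g(A) for the d x d minor of A on the rows g.  If A ~ B through t then
   p_g(B) = t^(c_g) p_g(A), with c_g = a + sum_k w_(g k); so WGr(d, n) is governed by
   its Pluecker coordinates, scaled with the positive weights c_g.  The stratum X_i is
   the locus where p_(lambda^k) vanishes for all k > i.  On X_j - X_(j-1) the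
   coordinate p_(lambda^j) is nonzero, and choosing t with t^(c_j) p_(lambda^j) = 1
   makes the rows lambda^j the identity matrix; what remains is a column echelon form
   with l(lambda^j) free entries, unique up to the choice of t, that is up to G(c_j).

   The map to C^l / G(c_j) is continuous because z |-> z^c is open, and it tends to
   infinity at X_(j-1): p_g(B)^(c_j) p_(lambda^j)(A)^(c_g) = p_g(A)^(c_j) holds for the
   normalization B of A, while p_(lambda^j)(A) tends to 0 and some p_g(A) does not.
   The inverse map is continuous at infinity because WGr(d, n) is compact: it is
   covered by the images of the sets of A that have an identity block and all entries
   of modulus at most 1. *)
Require Import Defs.
From mathcomp Require Import all_boot all_order all_algebra perm.
From mathcomp Require Import all_classical all_reals topology normedtype.
From mathcomp Require Import complex.

Set Implicit Arguments.
Unset Strict Implicit.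
Unset Printing Implicit Defensive.

Import Order.TTheory GRing.Theory Num.Theory.
Import numFieldNormedType.Exports.

Local Open Scope classical_set_scope.
Local Open Scope ring_scope.
Local Open Scope quotient_scope.

(** * Minors and Schubert symbols *)

Section Minors.
Variables (F : fieldType) (n d : nat).
Implicit Types (g h : 'I_d -> 'I_n) (A : 'M[F]_(n, d)).

Definition minor g A : F := \det (rowsub g A).

Definition upd g (j : 'I_d) (i : 'I_n) : 'I_d -> 'I_n :=
  fun k => if k == j then i else g k.

Lemma minor_scale g (u : 'rV[F]_n) A (T : 'M[F]_d) :
  minor g (diag_mx u *m A *m T) = (\prod_k u 0 (g k)) * minor g A * \det T.
Proof.
rewrite /minor -mul_rowsub_mx det_mulmx; congr (_ * _).
have -> : rowsub g (diag_mx u *m A) = diag_mx (\row_k u 0 (g k)) *m rowsub g A.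
  by apply/matrixP => i j; rewrite [LHS]mxE !mul_diag_mx !mxE.
by rewrite det_mulmx det_diag; congr (_ * _); apply: eq_bigr => k _; rewrite mxE.
Qed.

Lemma minor_perm g (s : 'S_d) A : minor (g \o s) A = (-1) ^+ s * minor g A.
Proof.
rewrite /minor -det_perm -det_mulmx -row_permE; congr (\det _).
by apply/matrixP => i j; rewrite !mxE.
Qed.

Lemma minor_neq0_inj g A : minor g A != 0 -> injective g.
Proof.
move=> nz i j e; apply/eqP/negPn/negP => ij; case/eqP: nz.
by apply: (determinant_alternate ij) => k; rewrite !mxE e.
Qed.

(** All rows but row [j] of the selected block are unit vectors, so expansion along column [j]
    leaves one term. Each entry of a normalized matrix is thus a Pluecker coordinate. *)
Lemma minor_upd g A j i : rowsub g A = 1%:M -> minor (upd g j i) A = A i j.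
Proof.
move=> gA; have gAE k l : A (g k) l = (k == l)%:R.
  by have /matrixP/(_ k l) := gA; rewrite !mxE.
rewrite /minor (expand_det_col _ j) (bigD1 j) //= mxE /upd eqxx big1 ?addr0.
  rewrite /cofactor (_ : row' _ _ = 1%:M) ?det1 ?mulr1.
    by rewrite -signr_odd oddD addbb mulr1.
  apply/matrixP => k l; rewrite !mxE eq_sym (negPf (neq_lift _ _)) gAE.
  by rewrite (inj_eq lift_inj).
by move=> k /negPf kj; rewrite mxE kj gAE kj mul0r.
Qed.

Lemma minor1 g A : rowsub g A = 1%:M -> minor g A = 1.
Proof. by move=> gA; rewrite /minor gA det1. Qed.

Lemma rank_minor g A : minor g A != 0 -> \rank A = d.
Proof.
move=> nz; apply/eqP; rewrite eqn_leq rank_leq_col /=.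
have {1}<- : \rank (rowsub g A) = d.
  by apply/eqP; rewrite -[_ == _]/(row_free _) row_free_unit unitmxE unitfE.
by rewrite rowsubE; exact: mxrankM_maxr.
Qed.

Lemma minor_ex A : \rank A = d -> exists g, minor g A != 0.
Proof.
move=> /eqP rA; have fA : row_full A by [].
exists (fullrankfun fA); rewrite -unitfE -unitmxE -row_full_unit.
exact: fullrowsub_full.
Qed.

End Minors.

Lemma card_lt_ord (k N : nat) : (k <= N)%N -> #|[pred i : 'I_N | i < k]%N| = k.
Proof. by move=> kN; rewrite -sum1_card (big_ord_narrow kN) sum1_card card_ord. Qed.

(** * Combinatorics of Schubert symbols: the order, sorting, and the count of free entries *)

Section SymbolOrder.
Variables (d n : nat).
Implicit Types (l m : schubert_symbol d n).

Lemma schubert_le_mono l (i j : 'I_d) :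
  (i <= j)%N -> (schubert_val l i <= schubert_val l j)%N.
Proof.
by rewrite leq_eqVlt => /orP[/eqP/val_inj-> //|/(schubert_lt l)/ltnW].
Qed.

(* If m_k < l_k then s maps [0, k] into, hence injectively into, [0, k). *)
Lemma schubert_le_perm l m (s : 'S_d) :
  (forall k, schubert_val l (s k) <= schubert_val m k)%N -> schubert_le l m.
Proof.
move=> le_s k; rewrite leqNgt; apply/negP => lt_k.
have sub (k' : 'I_d) : (k' <= k)%N -> (s k' < k)%N.
  move=> k'k; rewrite ltnNge; apply/negP => /(schubert_le_mono l) ks.
  move: lt_k; rewrite ltnNge => /negP; apply.
  exact: leq_trans ks (leq_trans (le_s k') (schubert_le_mono m k'k)).
have : (#|s @: [set k' : 'I_d | (k' <= k)%N]%SET|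
        <= #|[set k' : 'I_d | (k' < k)%N]%SET|)%N.
  apply/subset_leq_card/fintype.subsetP => _ /imsetP[k' + ->].
  by rewrite !inE; exact: sub.
rewrite card_imset; last exact: perm_inj.
have -> : #|[set k' : 'I_d | (k' < k)%N]%SET| = k.
  by rewrite cardsE; exact/card_lt_ord/ltnW.
have -> : #|[set k' : 'I_d | (k' <= k)%N]%SET| = k.+1.
  by rewrite cardsE; exact: (card_lt_ord (ltn_ord k)).
by rewrite ltnn.
Qed.

(** List the image of [g] in increasing order. Hence every minor on distinct rows is, up to sign, a
    minor on a Schubert symbol. *)
Lemma sort_inj (g : 'I_d -> 'I_n) : injective g ->
  exists l (s : 'S_d), schubert_val l =1 g \o s.
Proof.
move=> gi; pose S := (g @: [set: 'I_d])%SET.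
have cS : #|S| = d by rewrite card_imset // cardsT card_ord.
pose e (k : 'I_d) : 'I_n := enum_val (cast_ord (esym cS) k).
have eS k : e k \in S by exact: enum_valP.
have e_lt (i j : 'I_d) : (i < j)%N -> (e i < e j)%N.
  move=> ij; rewrite /e !(enum_val_nth (g i)) /=.
  have sortedS : sorted (fun x y : 'I_n => x < y)%N (enum S).
    rewrite /enum_mem; apply: sorted_filter; first by move=> ? ? ?; exact: ltn_trans.
    by have := iota_ltn_sorted 0 n; rewrite -val_enum_ord sorted_map enumT.
  apply: (sorted_ltn_nth _ _ sortedS) => //; first by move=> ? ? ?; exact: ltn_trans.
    by rewrite inE -cardE cS.
  by rewrite inE -cardE cS.
have pf : [forall i : 'I_d, forall j : 'I_d, (i < j)%N ==>
    ([ffun k => e k] i < [ffun k => e k] j)%N].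
  by apply/forallP => i; apply/forallP => j; apply/implyP; rewrite !ffunE; exact: e_lt.
pose l : schubert_symbol d n := exist _ [ffun k => e k] pf.
have lE k : schubert_val l k = e k by rewrite /schubert_val /= ffunE.
have ex k : exists i, g i == e k.
  by have /imsetP[i _ ->] := eS k; exists i.
pose s0 k := xchoose (ex k).
have s0E k : g (s0 k) = e k by exact/eqP/(xchooseP (ex k)).
have s0i : injective s0.
  by move=> i j eij; apply: (@schubert_inj _ _ l); rewrite !lE -!s0E eij.
by exists l, (perm s0i) => k; rewrite lE /= permE s0E.
Qed.

Lemma schubert_le_anti l m : schubert_le l m -> schubert_le m l -> l = m.
Proof.
move=> lm ml; apply/val_inj/ffunP => k; apply/val_inj/eqP.
by rewrite eqn_leq; apply/andP; split; [exact: lm|exact: ml].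
Qed.

(** The free entries of the reduced column echelon form with pivot rows [l], where each pivot is the
    last nonzero entry of its column. *)
Definition free_pos l : {set 'I_n * 'I_d} :=
  [set p : 'I_n * 'I_d | (p.1 < schubert_val l p.2)%N && (p.1 \notin codom (schubert_val l))]%SET.

(** Among the rows preceding the pivot of column [j], exactly [j] are pivot rows, namely those of
    the earlier columns. *)
Lemma card_free_pos l : #|free_pos l| = schubert_length l.
Proof.
rewrite /schubert_length -sum1_card.
transitivity (\sum_(j < d) \sum_(i < n | (i, j) \in free_pos l) 1)%N.
  rewrite (exchange_big_dep xpredT) //= pair_big_dep; by apply: eq_bigl => -[].
apply: eq_bigr => j _; rewrite sum1_card.
have ->: #|[pred i | (i, j) \in free_pos l]| =
    #|[predD [pred i : 'I_n | i < schubert_val l j]%N & codom (schubert_val l)]|.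
  by apply: eq_card => i; rewrite !inE andbC.
apply/eqP; rewrite -(eqn_add2l #|[predI [pred i : 'I_n | i < schubert_val l j]%N
  & codom (schubert_val l)]|) cardID card_lt_ord 1?ltnW //.
have -> : #|[predI [pred i : 'I_n | i < schubert_val l j]%N & codom (schubert_val l)]| = j.
  rewrite -[RHS](@card_lt_ord j d) 1?ltnW // -(fintype.card_image (@schubert_inj _ _ l)).
  apply: eq_card => i; rewrite !inE; apply/andP/fintype.imageP => [[lt /codomP[k ek]]|[k]].
    exists k => //; rewrite inE ltnNge; apply/negP => /(schubert_le_mono l).
    by rewrite -ek leqNgt lt.
  by rewrite inE => /(schubert_lt l) lt ->; split => //; exact: codom_f.
rewrite subnKC //.
(* The truncated subtraction is exact: the [j] earlier pivots are distinct rows preceding pivot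
   [j]. *)
have /subset_leq_card : fintype.image (schubert_val l) [pred k : 'I_d | k < j]%N
    \subset [pred i : 'I_n | i < schubert_val l j]%N.
  apply/fintype.subsetP => i /fintype.imageP[k + ->].
  by rewrite !inE => /(schubert_lt l).
by rewrite (fintype.card_image (@schubert_inj _ _ l)) !card_lt_ord // ltnW.
Qed.

End SymbolOrder.

(** * Normal forms of frames *)

Section Chart.
Variables (R : realType) (n d : nat) (w : 'I_n -> nat) (a : nat).
Hypothesis a_gt0 : (0 < a)%N.
Local Notation C := (Cplx R).
Local Notation frame := (frame R n d).
Implicit Types (A B : frame) (g h : 'I_d -> 'I_n).

(** Defined for every row selection, since the selections [upd g j i] that read off entries need not
    be sorted. On a symbol it is [schubert_weight]. *)
Definition minor_weight g : nat := (a + \sum_(k < d) w (g k))%N.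
Local Notation cw := minor_weight.

Lemma minor_weight_gt0 g : (0 < cw g)%N.
Proof. by rewrite addn_gt0 a_gt0. Qed.

Lemma minor_weight_mx g t (M : 'M[C]_(n, d)) (T : 'M[C]_d) :
  minor g (weight_mx w t *m M *m T) =
  t ^+ (\sum_(k < d) w (g k)) * minor g M * \det T.
Proof.
rewrite minor_scale; congr (_ * _ * _).
rewrite (big_morph (fun e => t ^+ e) (exprD t) (expr0 t)).
by apply: eq_bigr => k _; rewrite mxE.
Qed.

Lemma wrel_minor A B : wrel w a A B ->
  exists2 t, t != 0 & forall g, minor g (\val B) = t ^+ cw g * minor g (\val A).
Proof.
move=> /asboolP[t [T [t0 _ tT ->]]]; exists t => // g.
by rewrite minor_weight_mx -tT exprD mulrAC [X in X * _]mulrC.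
Qed.

Definition mk_frame (M : 'M[C]_(n, d)) (rM : \rank M = d) : frame :=
  exist (fun M => M \in @frame_set R n d) M (mem_set rM).

(** Making the rows [g] the identity forces [T] to be the inverse of that block of the rescaled
    matrix; the hypothesis on [s] says precisely that this [T] satisfies [s ^+ a = \det T]. *)
Lemma wrel_normalize A g s : s ^+ cw g * minor g (\val A) = 1 ->
  exists B, [/\ wrel w a A B, rowsub g (\val B) = 1%:M
    & forall h, minor h (\val B) = s ^+ cw h * minor h (\val A)].
Proof.
move=> sg; have s0 : s != 0.
  apply/eqP => s0; move: sg; rewrite s0 expr0n.
  by rewrite eqn0Ngt minor_weight_gt0 mul0r => /esym/eqP; rewrite oner_eq0.
pose N := weight_mx w s *m \val A; pose T := invmx (rowsub g N).
have dN : s ^+ a * \det (rowsub g N) = 1.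
  rewrite -/(minor g N) -[N]mulmx1 minor_weight_mx det1 mulr1 mulrA -exprD.
  exact: sg.
have N0 : \det (rowsub g N) != 0.
  by apply/eqP => N0; move/eqP: dN; rewrite N0 mulr0 eq_sym oner_eq0.
have uN : rowsub g N \in unitmx by rewrite unitmxE unitfE.
have dT : s ^+ a = \det T by rewrite det_inv; apply: (mulIf N0); rewrite dN mulVf.
have gB : rowsub g (N *m T) = 1%:M by rewrite -mul_rowsub_mx mulmxV.
have rB : \rank (N *m T) = d.
  by apply: (@rank_minor _ _ _ g); rewrite minor1 // oner_neq0.
exists (mk_frame rB); split=> //.
- by apply/asboolP; exists s, T; split=> //; rewrite unitmx_inv.
- by move=> h; rewrite /= /N minor_weight_mx -dT exprD mulrAC [X in X * _]mulrC.
Qed.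

Variable l : schubert_symbol d n.
Local Notation lv := (schubert_val l).
Local Notation len := (schubert_length l).

Definition free_entry (k : 'I_len) : 'I_n * 'I_d :=
  enum_val (cast_ord (esym (card_free_pos l)) k).

Local Notation fr k := (free_entry k).1.
Local Notation fc k := (free_entry k).2.

Lemma free_entry_inj : injective free_entry.
Proof. by move=> j k /enum_val_inj/cast_ord_inj. Qed.

Lemma free_entryP k : (fr k < lv (fc k))%N /\ fr k \notin codom lv.
Proof. by have := enum_valP (cast_ord (esym (card_free_pos l)) k); rewrite inE => /andP. Qed.

Lemma free_entry_ex (i : 'I_n) j : (i < lv j)%N -> i \notin codom lv ->
  exists k, free_entry k = (i, j).
Proof.
move=> ij il; have ijF : (i, j) \in free_pos l by rewrite inE ij.
exists (cast_ord (card_free_pos l) (enum_rank_in ijF (i, j))).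
by rewrite /free_entry cast_ordK enum_rankK_in.
Qed.

(** At most one term of the sum is nonzero, as [free_entry] is injective. In this form every entry
    is visibly continuous in [v]. *)
Definition cell_mx (v : 'cV[C]_len) : 'M[C]_(n, d) :=
  \matrix_(i, j) ((i == lv j)%:R + \sum_k v k 0 * (free_entry k == (i, j))%:R).

Lemma cell_mx_pivot v : rowsub lv (cell_mx v) = 1%:M.
Proof.
apply/matrixP => i j; rewrite !mxE (inj_eq (@schubert_inj _ _ l)).
rewrite big1 ?addr0 // => k _; have [_ /codomP nk] := free_entryP k.
by case: eqP => [e|]; rewrite ?mulr0 //; case: nk; exists i; rewrite e.
Qed.

Lemma cell_mx_free v k : cell_mx v (fr k) (fc k) = v k 0.
Proof.
rewrite mxE (bigD1 k) //= -surjective_pairing eqxx mulr1 big1 => [|k' /negPf kk'].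
  have [/ltn_eqF lt _] := free_entryP k.
  by rewrite addr0 -val_eqE /= lt add0r.
by rewrite (inj_eq free_entry_inj) kk' mulr0.
Qed.

Lemma cell_mx_notfree v i j :
  i != lv j -> (forall k, free_entry k != (i, j)) -> cell_mx v i j = 0.
Proof.
move=> /negPf ij nk; rewrite mxE ij add0r big1 // => k _.
by rewrite (negPf (nk k)) mulr0.
Qed.

Lemma cell_mx_above v (i : 'I_n) j : (lv j < i)%N -> cell_mx v i j = 0.
Proof.
move=> ji; apply: cell_mx_notfree; first by rewrite -val_eqE gtn_eqF.
move=> k; have [+ _] := free_entryP k.
by apply: contraTneq => -> /=; rewrite -leqNgt ltnW.
Qed.

Lemma cell_mx_rank v : \rank (cell_mx v) = d.
Proof.
by apply: (@rank_minor _ _ _ lv); rewrite minor1 ?oner_neq0 // cell_mx_pivot.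
Qed.

Definition cell_frame v : frame := mk_frame (cell_mx_rank v).

Lemma cell_mx0 : cell_mx 0 = schubert_mx R l.
Proof.
by apply/matrixP => i j; rewrite !mxE big1 ?addr0 // => k _; rewrite mxE mul0r.
Qed.

(** A nonzero term of the Leibniz expansion gives a permutation [s] for which the entry in row [m i]
    and column [s i] is nonzero, hence [m i <= l (s i)]; sorting removes [s]. *)
Lemma minor_cell_mx v m : minor (schubert_val m) (cell_mx v) != 0 -> schubert_le m l.
Proof.
move=> nz; have [s ns] : exists s : 'S_d,
    \prod_i rowsub (schubert_val m) (cell_mx v) i (s i) != 0.
  apply: contra_notP (negP nz) => /forallNP H; rewrite /minor /determinant big1 //.
  by move=> s _; have /negP := H s; rewrite negbK => /eqP->; rewrite mulr0.
apply: (@schubert_le_perm _ _ _ _ s^-1%g) => k.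
rewrite leqNgt; apply/negP => lt; move/prodf_neq0: ns => /(_ (s^-1 k)%g isT).
by rewrite mxE permKV cell_mx_above ?eqxx.
Qed.

(* The free entries of the representative of [M] whose pivot rows form the identity
   matrix, provided s ^+ c * minor lv M = 1. *)
Definition cell_coord (s : C) (M : 'M[C]_(n, d)) : 'cV[C]_len :=
  \col_k (s ^+ cw (upd lv (fc k) (fr k)) * minor (upd lv (fc k) (fr k)) M).

(** Only symbols above [l] are constrained, which is weaker than the vanishing at all symbols not
    below [l] that defines a Schubert variety. It still forces the echelon form wherever the minor
    at [l] is nonzero. *)
Definition in_closed_cell (M : 'M[C]_(n, d)) : Prop :=
  forall m, schubert_le l m -> m <> l -> minor (schubert_val m) M = 0.

(** Moving one pivot to a later, non-pivot row and sorting yields a symbol strictly above [l]. *)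
Lemma minor_upd_above (M : 'M[C]_(n, d)) (i : 'I_n) j : in_closed_cell M ->
  (lv j < i)%N -> i \notin codom lv -> minor (upd lv j i) M = 0.
Proof.
move=> Ml ji il; have gi : injective (upd lv j i).
  move=> x y; rewrite /upd; case: eqP => [->|_]; case: eqP => [->|_] //.
  - by move=> e; move: il; rewrite e codom_f.
  - by move=> e; move: il; rewrite -e codom_f.
  - by move/schubert_inj.
have [m [s ms]] := sort_inj gi.
have -> : minor (upd lv j i) M = (-1) ^+ s * minor (schubert_val m) M.
  have -> : minor (schubert_val m) M = minor (upd lv j i \o s) M.
    by congr (\det _); apply/matrixP => x y; rewrite !mxE ms.
  by rewrite minor_perm signrMK.
rewrite Ml ?mulr0 //.
  apply: (@schubert_le_perm _ _ _ _ s) => k; rewrite ms /= /upd.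
  by case: eqP => [->|//]; exact: ltnW.
move=> ml; move: il; rewrite -ml => /codomP; apply.
by exists (s^-1 j)%g; rewrite ms /= permKV /upd eqxx.
Qed.

(** The entries of the normalized representative are rescaled minors of [A]: those past a pivot
    vanish, and the free ones are [cell_coord] by definition. *)
Lemma wrel_cell A s : in_closed_cell (\val A) -> s ^+ cw lv * minor lv (\val A) = 1 ->
  wrel w a A (cell_frame (cell_coord s (\val A))).
Proof.
move=> Al /wrel_normalize[B [AB Bl Bm]].
suff -> : cell_frame (cell_coord s (\val A)) = B by [].
apply/val_inj/matrixP => i j /=.
have [/codomP[k ->]|il] := boolP (i \in codom lv).
  have /matrixP/(_ k j) := Bl; rewrite !mxE => ->.
  have /matrixP/(_ k j) := cell_mx_pivot (cell_coord s (\val A)).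
  by rewrite !mxE.
have [ij|ji|/val_inj ij] := ltngtP i (lv j).
- have [k e] := free_entry_ex ij il.
  have := cell_mx_free (cell_coord s (\val A)) k; rewrite e /= => ->.
  by rewrite mxE e /= -Bm minor_upd.
- by rewrite cell_mx_above // -(minor_upd _ _ Bl) Bm minor_upd_above ?mulr0.
- by move: il; rewrite ij codom_f.
Qed.

(** The effect on the free entries of replacing the normalizing factor [s] by [z * s], for [z] a
    root of unity of order dividing the weight of [l]. *)
Definition cell_action_mx (z : C) : 'M[C]_len :=
  diag_mx (\row_k (z ^+ w (fr k) / z ^+ w (lv (fc k)))).

Lemma cell_action_mx1 : cell_action_mx 1 = 1%:M.
Proof.
rewrite -diag_const_mx; congr diag_mx.
by apply/rowP => i; rewrite !mxE !expr1n divr1.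
Qed.

Lemma cell_action_mxM y z :
  cell_action_mx (y * z) = cell_action_mx y *m cell_action_mx z.
Proof.
rewrite mulmx_diag; congr diag_mx.
by apply/rowP => i; rewrite !mxE !exprMn invfM mulrACA.
Qed.

Definition cell_action : linear_action R (schubert_weight w a l) len :=
  @LinearAction R (schubert_weight w a l) len cell_action_mx cell_action_mx1
    (fun y z _ _ => cell_action_mxM y z).

Lemma cell_coordM z s M : z ^+ cw lv = 1 ->
  cell_coord (z * s) M = cell_action_mx z *m cell_coord s M.
Proof.
move=> z1; have z0 : z != 0.
  apply/eqP => z0; move/eqP: z1; rewrite z0 expr0n eqn0Ngt minor_weight_gt0.
  by rewrite eq_sym oner_eq0.
apply/colP => k; rewrite mul_diag_mx !mxE exprMn -[LHS]mulrA; congr (_ * _).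
apply: (canRL (mulfK _)); rewrite ?expf_neq0 // -exprD.
(* Multiplying by [z ^+ cw lv = 1] reduces the claim to an equality of exponents: the two weights
   differ only in the exchanged row. *)
rewrite -[RHS]mulr1 -z1 -exprD; congr (_ ^+ _).
rewrite /cw (bigD1 (fc k)) //= [in RHS](bigD1 (fc k)) //= /upd eqxx.
rewrite (eq_bigr (fun k' => w (lv k'))) => [|k' /negPf-> //].
by rewrite -!addnA addnCA; congr (_ + (_ + _))%N; rewrite addnC.
Qed.

Lemma cell_coord_cell s v : s ^+ cw lv = 1 ->
  cell_coord s (cell_mx v) = cell_action_mx s *m v.
Proof.
move=> s1; rewrite -[s in LHS]mulr1 cell_coordM //; congr (_ *m _).
by apply/colP => k; rewrite !mxE expr1n mul1r minor_upd ?cell_mx_pivot // cell_mx_free.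
Qed.

End Chart.

(** * Matrix and quotient topologies *)

Section MatrixTopology.
Variable K : numFieldType.

Lemma mx_cvg (T : Type) (F : set_system T) m n (f : T -> 'M[K]_(m, n)) (M : 'M[K]_(m, n)) :
  Filter F -> (forall i j, f x i j @[x --> F] --> M i j) -> f @ F --> M.
Proof.
move=> FF fM U [P MP PU].
have H : \forall x \near F, forall ij : 'I_m * 'I_n, P ij.1 ij.2 (f x ij.1 ij.2).
  by apply: filter_forall => -[i j]; apply: fM; exact: MP.
by apply: filterS H => x Px; apply: PU => i j; exact: (Px (i, j)).
Qed.

Lemma mx_continuous (T : topologicalType) m n (f : T -> 'M[K]_(m, n)) :
  (forall i j, continuous (fun x => f x i j)) -> continuous f.
Proof. by move=> fc x; apply: mx_cvg => i j; exact: fc. Qed.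

Lemma nbhs_neq0 (x : K) : x != 0 -> nbhs x [set y | y != 0].
Proof. by move=> x0; apply: (@cvgr_neq0 K K^o _ (nbhs x) _ id x) => //; exact: cvg_id. Qed.

Lemma add_fun_continuous (T : topologicalType) (f g : T -> K) :
  continuous f -> continuous g -> continuous (fun x => f x + g x).
Proof. by move=> fc gc x; apply: cvgD; [exact: fc|exact: gc]. Qed.

Lemma mul_fun_continuous (T : topologicalType) (f g : T -> K) :
  continuous f -> continuous g -> continuous (fun x => f x * g x).
Proof. by move=> fc gc x; apply: cvgM; [exact: fc|exact: gc]. Qed.

Lemma exp_fun_continuous (T : topologicalType) (f : T -> K) e :
  continuous f -> continuous (fun x => f x ^+ e).
Proof.
move=> fc; elim: e => [|e IH]; first exact: cst_continuous.
by under eq_fun do rewrite exprS; exact: mul_fun_continuous.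
Qed.

Lemma sum_continuous (T : topologicalType) (I : Type) (r : seq I) (P : pred I)
    (f : I -> T -> K) :
  (forall i, P i -> continuous (f i)) -> continuous (fun x => \sum_(i <- r | P i) f i x).
Proof. by apply: continuous_big; exact: add_continuous. Qed.

Lemma prod_continuous (T : topologicalType) (I : Type) (r : seq I) (P : pred I)
    (f : I -> T -> K) :
  (forall i, P i -> continuous (f i)) -> continuous (fun x => \prod_(i <- r | P i) f i x).
Proof. by apply: continuous_big; exact: mul_continuous. Qed.

Lemma mulmx_continuous (T : topologicalType) m n p (f : T -> 'M[K]_(m, n))
    (g : T -> 'M[K]_(n, p)) :
  continuous f -> continuous g -> continuous (fun x => f x *m g x).
Proof.
move=> fc gc; apply: mx_continuous => i j.
under eq_fun do rewrite mxE.
apply: sum_continuous => k _; apply: mul_fun_continuous => x.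
  by apply: (cvg_comp f (fun M => M i k) (fc x)); exact: coord_continuous.
by apply: (cvg_comp g (fun M => M k j) (gc x)); exact: coord_continuous.
Qed.

Lemma minor_continuous n d (g : 'I_d -> 'I_n) :
  continuous (minor g : 'M[K]_(n, d) -> K).
Proof.
rewrite /minor /determinant; apply: sum_continuous => s _.
apply: mul_fun_continuous; first exact: cst_continuous.
apply: prod_continuous => i _.
under eq_fun do rewrite mxE.
exact: coord_continuous.
Qed.

End MatrixTopology.

Lemma set_type_continuous (T U : topologicalType) (A : set U) (f : T -> set_type A) :
  continuous (\val \o f) -> continuous f.
Proof. exact: continuous_comp_initial. Qed.

Lemma set_val_continuous (U : topologicalType) (A : set U) :
  continuous (\val : set_type A -> U).
Proof. exact: initial_continuous. Qed.

Lemma set_val_near (U : topologicalType) (A : set U) (x : set_type A) (P : set U) :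
  nbhs (\val x) P -> nbhs x [set y : set_type A | P (\val y)].
Proof. by move=> xP; exact: (@set_val_continuous U A x P xP). Qed.

(** The saturation of an open set [V] is a neighbourhood of each of its points [b]: the preimage of
    [V] under a class-preserving map [phi] that sends [b] into [V] contains [b] and lies in the
    saturation. *)
Lemma quotient_pi_open (T : topologicalType) (Q0 : quotType T) :
  let Q := quotient_topology Q0 in
  (forall a b, \pi_Q a = \pi_Q b -> exists phi : T -> T,
    [/\ continuous phi, phi b = a & forall x, \pi_Q (phi x) = \pi_Q x]) ->
  forall a N, nbhs a N -> nbhs (\pi_Q a) (\pi_Q @` N).
Proof.
move=> Q H a N; rewrite [in X in X -> _]nbhsE => -[V [oV Va] VN].
apply: (@filterS _ _ _ (\pi_Q @` V)); first exact: image_subset.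
apply: open_nbhs_nbhs; split; last by exists a.
rewrite /open /= /quotient_open openE => b [x Vx] /H[phi [cphi phib piphi]].
apply: (@filterS _ _ _ (phi @^-1` V)) => [y Vy|]; first by exists (phi y).
by apply: cphi; rewrite phib; exact: open_nbhs_nbhs.
Qed.

(** * Continuity of complex roots, and compact boxes of complex matrices *)

Section ComplexTopology.
Variable R : realType.
Local Notation C := (Cplx R).

(* t^c - s is the product of the t - z over the c roots z of X^c - s, so one of these
   roots is close to t when s is close to t^c. *)
Lemma root_near (c : nat) (t : C) (N : set C) : (0 < c)%N -> nbhs t N ->
  \forall s \near t ^+ c, exists2 u, N u & u ^+ c = s.
Proof.
move=> c0 /nbhs_ballP[e /= e0 eN].
apply/nbhs_ballP; exists (e ^+ c); first exact: exprn_gt0.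
move=> s ts; have {}ts : `|t ^+ c - s| < e ^+ c by [].
have [r rE] := closed_field_poly_normal ('X^c - s%:P : {poly C}).
rewrite lead_coefXnsubC // scale1r in rE.
have rs z : z \in r -> z ^+ c = s.
  rewrite -root_prod_XsubC -rE => /rootP.
  by rewrite !hornerE => /eqP; rewrite subr_eq0 => /eqP.
have sr : size r = c.
  by have := congr1 (fun p : {poly C} => size p) rE; rewrite size_XnsubC // size_prod_XsubC => -[].
have [[z zr tz]|nz] := pselect (exists2 z, z \in r & `|t - z| < e).
  by exists z; [exact: eN|exact: rs].
suff : e ^+ c <= `|t ^+ c - s|.
  by move=> /(lt_le_trans ts); rewrite ltxx.
have -> : t ^+ c - s = \prod_(z <- r) (t - z).
  have := congr1 (fun p : {poly C} => p.[t]) rE.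
  by rewrite horner_prod !hornerE => ->; apply: eq_bigr => z _; rewrite !hornerE.
have -> : e ^+ c = \prod_(z <- r) e by rewrite big_const_seq count_predT sr iter_mulr_1.
rewrite normr_prod.
rewrite !big_seq; apply: ler_prod => z zr; rewrite (ltW e0) /=.
rewrite real_leNgt ?normr_real ?gtr0_real //; apply/negP => tz.
by apply: nz; exists z.
Qed.

Definition cplx_of (p : R * R) : C := (p.1 +i* p.2)%C.

Lemma cplx_of_continuous : continuous cplx_of.
Proof.
have rc : continuous (fun x : R => (x%:C)%C : C).
  move=> x U /nbhs_ballP[e /= e0 eU].
  (* The radius of a ball in the complex numbers is itself a complex number; being positive it is
     real, and its real part serves as a radius in [R]. *)
  have eR : ((complex.Re (e : R[i]))%:C)%C = (e : R[i]) by apply: RRe_real; exact: gtr0_real.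
  apply/nbhs_ballP; exists (complex.Re (e : R[i])) => /=; first by rewrite -ltcR eR.
  move=> y xy; apply: eU; suff : `|(x%:C)%C - (y%:C)%C : R[i]| < e by [].
  by rewrite -eR -rmorphB normc_def /= expr0n addr0 sqrtr_sqr ltcR.
have -> : cplx_of = (fun p => (p.1%:C)%C + 'i%C * (p.2%:C)%C).
  by apply/funext => p; exact: (complexE (p.1 +i* p.2)%C).
move=> p; apply: cvgD.
  by apply: (@continuous_comp _ _ _ fst _ p); [exact: cvg_fst|exact: rc].
apply: cvgM; first exact: cvg_cst.
by apply: (@continuous_comp _ _ _ snd _ p); [exact: cvg_snd|exact: rc].
Qed.

(** A compact set containing the closed unit disc; as the image of a real square it inherits
    compactness from segments. *)
Definition cplx_square : set C := cplx_of @` (`[-1, 1] `*` `[-1, 1]).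

Lemma cplx_square_compact : compact cplx_square.
Proof.
apply: continuous_compact; first exact/continuous_subspaceT/cplx_of_continuous.
by apply: compact_setX; exact: segment_compact.
Qed.

Lemma cplx_square_disc z : `|z| <= 1 -> cplx_square z.
Proof.
case: z => x y; rewrite normc_def lecR /= => xy; exists (x, y) => //.
have le1 : x ^+ 2 + y ^+ 2 <= 1.
  by rewrite -(sqr_sqrtr (addr_ge0 (sqr_ge0 x) (sqr_ge0 y))) expr_le1 ?sqrtr_ge0.
split; rewrite /= in_itv /= -ler_norml -(@expr_le1 _ 2) ?normr_ge0 //;
  rewrite real_normK ?num_real //; apply: le_trans le1.
- by rewrite lerDl sqr_ge0.
- by rewrite lerDr sqr_ge0.
Qed.

Lemma mx_square_compact m n :
  compact [set M : 'M[C]_(m, n) | forall i j, cplx_square (M i j)].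
Proof.
have -> : [set M : 'M[C]_(m, n) | forall i j, cplx_square (M i j)] =
    vec_mx @` [set v : 'rV[C]_(m * n) | forall i, cplx_square (v ord0 i)].
  apply/seteqP; split=> [M Ms|_ [v vs <-] i j /=]; last by rewrite mxE.
  exists (mxvec M); last exact: mxvecK.
  by move=> k /=; case/mxvec_indexP: k => i j; rewrite mxvecE.
apply: continuous_compact; last first.
  exact: (@rV_compact C _ (fun _ => cplx_square) (fun _ => cplx_square_compact)).
apply: continuous_subspaceT; apply: mx_continuous => i j.
under eq_fun do rewrite mxE.
exact: coord_continuous.
Qed.

End ComplexTopology.

(** * Compactness of the weighted Grassmannian *)

Lemma real_argmax (K : numDomainType) (I : finType) (i0 : I) (f : I -> K) :
  (forall i, f i \is Num.real) -> exists i, forall j, f j <= f i.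
Proof.
move=> fr; suff H (s : seq I) : exists i, forall j, j \in s -> f j <= f i.
  by have [i fi] := H (enum I); exists i => j; apply: fi; rewrite mem_enum.
elim: s => [|k s [i fi]]; first by exists i0.
have [ki|/ltW ik] := real_leP (fr k) (fr i); [exists i|exists k] => j;
  rewrite inE => /orP[/eqP->|/fi] //.
by move=> /le_trans; apply.
Qed.

Section WeightedGrassmannTopology.
Variables (R : realType) (n d : nat) (w : 'I_n -> nat) (a : nat).
Hypothesis a_gt0 : (0 < a)%N.
Local Notation C := (Cplx R).
Local Notation frame := (frame R n d).
Local Notation cw := (minor_weight w a).
Local Notation WGr := (WGr R d w a).
Implicit Types (A B : frame) (g h : 'I_d -> 'I_n).

Lemma WGr_eqP A B : \pi_WGr A = \pi_WGr B <-> wrel w a A B.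
Proof. by split=> [/eqmodP|AB]; last exact/eqmodP. Qed.

Lemma WGr_surj (x : WGr) : exists A, x = \pi_WGr A.
Proof. by exists (repr x); rewrite reprK. Qed.

Lemma frame_val_continuous : continuous (\val : frame -> 'M[C]_(n, d)).
Proof. exact: set_val_continuous. Qed.

Lemma frame_val_near A (P : set 'M[C]_(n, d)) :
  nbhs (\val A) P -> nbhs A [set B | P (\val B)].
Proof. exact: set_val_near. Qed.

Lemma mk_frame_continuous (T : topologicalType) (f : T -> 'M[C]_(n, d))
    (rf : forall x, \rank (f x) = d) :
  continuous f -> continuous (fun x => mk_frame (rf x) : frame).
Proof. by move=> fc; apply: set_type_continuous. Qed.

Lemma rank_weight_mx A (t : C) (T : 'M[C]_d) : t != 0 -> T \in unitmx ->
  \rank (weight_mx w t *m \val A *m T) = d.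
Proof.
move=> t0 uT; have [g gA] := minor_ex (frameP A).
apply: (@rank_minor _ _ _ g); rewrite minor_weight_mx.
by rewrite !mulf_neq0 ?expf_neq0 // -unitfE -unitmxE.
Qed.

Lemma WGr_pi_open A (N : set frame) : nbhs A N -> nbhs (\pi_WGr A) (\pi_WGr @` N).
Proof.
apply: quotient_pi_open => {N}A B /esym/WGr_eqP/asboolP[t [T [t0 uT tT eA]]].
exists (fun A' => mk_frame (rank_weight_mx A' t0 uT)); split.
- apply: mk_frame_continuous; apply: mulmx_continuous; last exact: cst_continuous.
  by apply: mulmx_continuous; [exact: cst_continuous|exact: frame_val_continuous].
- exact/val_inj.
- by move=> A'; apply/esym/WGr_eqP/asboolP; exists t, T.
Qed.

Lemma minor_wrel A B g : wrel w a A B ->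
  (minor g (\val A) == 0) = (minor g (\val B) == 0).
Proof. by move=> /wrel_minor[t t0 ->]; rewrite mulf_eq0 expf_eq0 (negPf t0) andbF. Qed.

Lemma wrel_repr A : wrel w a A (repr (\pi_WGr A)).
Proof. by apply/WGr_eqP; rewrite reprK. Qed.

Definition minor_locus (S : set ('I_d -> 'I_n)) : set WGr :=
  [set x | forall g, S g -> minor g (\val (repr x)) = 0].

Lemma minor_locusE S A :
  minor_locus S (\pi_WGr A) <-> (forall g, S g -> minor g (\val A) = 0).
Proof.
by split=> H g /H/eqP; [rewrite -(minor_wrel _ (wrel_repr A))|
  rewrite (minor_wrel _ (wrel_repr A))] => /eqP.
Qed.

Lemma minor_locus_closed S : closed (minor_locus S).
Proof.
rewrite -openC /open /= /quotient_open -preimage_setC openC.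
have -> : \pi_WGr @^-1` (minor_locus S) =
    \bigcap_(g in S) ((fun A => minor g (\val A)) @^-1` [set 0]).
  by apply/seteqP; split=> A /=; rewrite minor_locusE.
apply: closed_bigI => g _; apply: (@closed_comp _ _ _ [set 0]) => [A _|].
  by apply: continuous_comp; [exact: frame_val_continuous|exact: minor_continuous].
exact/accessible_closed_set1/hausdorff_accessible/norm_hausdorff.
Qed.

Lemma scale_frame_minor (t : torus R n) A g :
  minor g (\val (scale_frame t A)) = (\prod_k \val t 0 (g k)) * minor g (\val A).
Proof. by rewrite /= -[LHS]/(minor g (_ *m _)) -[_ *m _]mulmx1 minor_scale det1 mulr1. Qed.

Lemma scale_frame_minor_eq0 (t : torus R n) A g :
  (minor g (\val (scale_frame t A)) == 0) = (minor g (\val A) == 0).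
Proof.
rewrite scale_frame_minor mulf_eq0; case: eqP => //= e.
by move: (introT eqP e) => /negPn; rewrite prodf_seq_neq0; case/allP => ? _; exact: torusP.
Qed.

Lemma minor_locus_act S (t : torus R n) x :
  minor_locus S x -> minor_locus S (WGr_act t x).
Proof.
rewrite -[x]reprK WGr_actE !minor_locusE => H g Sg.
by apply/eqP; rewrite scale_frame_minor_eq0 H.
Qed.

(** Overwriting the rows [g] by the identity extends the chart at [g] to a continuous map on all
    matrices, with values of full rank when [g] is injective. *)
Definition pin g (M : 'M[C]_(n, d)) : 'M[C]_(n, d) :=
  \matrix_(i, j) (if [pick k | g k == i] is Some k then (k == j)%:R else M i j).

Lemma pin_pivot g M : injective g -> rowsub g (pin g M) = 1%:M.
Proof.
move=> gi; apply/matrixP => i j; rewrite !mxE.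
by case: pickP => [k /eqP/gi-> //|/(_ i)]; rewrite eqxx.
Qed.

Lemma pin_id g M : rowsub g M = 1%:M -> pin g M = M.
Proof.
move=> gM; apply/matrixP => i j; rewrite !mxE; case: pickP => [k /eqP<-|//].
by have /matrixP/(_ k j) := gM; rewrite !mxE.
Qed.

Lemma pin_rank g M : injective g -> \rank (pin g M) = d.
Proof. by move=> gi; apply: (@rank_minor _ _ _ g); rewrite minor1 ?oner_neq0 ?pin_pivot. Qed.

Lemma pin_continuous g : continuous (pin g).
Proof.
apply: mx_continuous => i j; under eq_fun do rewrite mxE.
by case: pickP => [k _|_]; [exact: cst_continuous|exact: coord_continuous].
Qed.

Lemma pinned_compact g : exists K : set WGr, compact K /\
  forall A, rowsub g (\val A) = 1%:M -> (forall i j, `|\val A i j| <= 1) -> K (\pi_WGr A).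
Proof.
have [gi|gni] := pselect (injective g); last first.
  (* For [g] not injective no frame has the identity on the rows [g], so the empty set will do. *)
  exists set0; split=> [|A gA _]; first exact: compact0.
  by apply: gni; apply: (@minor_neq0_inj _ _ _ _ (\val A)); rewrite minor1 ?oner_neq0.
pose f M : WGr := \pi_WGr (mk_frame (pin_rank M gi)).
have fc : continuous f.
  move=> M; apply: (@continuous_comp _ _ _ (fun M => mk_frame (pin_rank M gi) : frame)).
    by apply: mk_frame_continuous; exact: pin_continuous.
  exact: pi_continuous.
exists (f @` [set M : 'M[C]_(n, d) | forall i j, cplx_square (M i j)]); split.
  apply: continuous_compact; last exact: mx_square_compact.
  exact: continuous_subspaceT.
move=> A gA A1; exists (\val A).
  by move=> i j /=; exact/cplx_square_disc/A1.
by congr \pi_WGr; apply: val_inj; rewrite /= pin_id.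
Qed.

(* Normalize at the g that maximizes |p_g|^(1/c_g): then every |p_h| is at most 1. *)
Lemma bounded_representative A : exists g B,
  [/\ wrel w a A B, rowsub g (\val B) = 1%:M & forall i j, `|\val B i j| <= 1].
Proof.
pose f g : C := (cw g).-root `|minor g (\val A)|.
have f0 g : 0 <= f g by rewrite rootC_ge0 ?minor_weight_gt0.
have fX g : f g ^+ cw g = `|minor g (\val A)| by rewrite rootCK ?minor_weight_gt0.
have [g0 g0A] := minor_ex (frameP A).
have [q fmax] := @real_argmax C {ffun 'I_d -> 'I_n} (finfun g0)
  (fun q : {ffun 'I_d -> 'I_n} => f (fun k => q k)) (fun _ => ger0_real (f0 _)).
pose g k := q k; have {}fmax h : f h <= f g.
  have := fmax (finfun h); rewrite (_ : (fun k => finfun h k) = h) //.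
  by apply/funext => k; rewrite ffunE.
have fg : 0 < f g.
  apply: lt_le_trans (fmax g0); rewrite lt_def f0 andbT.
  apply/eqP => e; move: g0A; rewrite -normr_eq0 -fX e expr0n.
  by rewrite eqn0Ngt minor_weight_gt0 // eqxx.
have gA : minor g (\val A) != 0.
  by rewrite -normr_eq0 -fX expf_neq0 // gt_eqF.
pose s : C := (cw g).-root (minor g (\val A))^-1.
have sX : s ^+ cw g * minor g (\val A) = 1.
  by rewrite rootCK ?minor_weight_gt0 // mulVf.
have ns : `|s| = (f g)^-1.
  apply/eqP; rewrite -(@eqrXn2 _ (cw g)) ?minor_weight_gt0 ?invr_ge0 //.
  by rewrite exprVn fX -normrX rootCK ?minor_weight_gt0 // normfV.
have [B [AB gB Bm]] := wrel_normalize a_gt0 sX.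
exists g, B; split=> // i j; rewrite -(minor_upd _ _ gB) Bm normrM normrX ns -fX.
rewrite -exprMn; apply: exprn_ile1; first by rewrite mulr_ge0 ?invr_ge0.
by rewrite mulrC ler_pdivrMr // mul1r.
Qed.

Lemma WGr_compact : compact [set: WGr].
Proof.
have [K KP] := choice (pinned_compact).
have -> : [set: WGr] = \big[setU/set0]_(g : {ffun 'I_d -> 'I_n}) K g.
  apply/seteqP; split=> // x _; rewrite -[x]reprK.
  have [g [B [/WGr_eqP-> gB B1]]] := bounded_representative (repr x).
  rewrite -bigcup_seq; exists (finfun g); first by rewrite /= mem_index_enum.
  have -> : (finfun g : 'I_d -> 'I_n) = g by apply/funext => k; rewrite ffunE.
  by have [_] := KP g; apply.
by apply: bigsetU_compact => g _; have [] := KP g.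
Qed.

End WeightedGrassmannTopology.

(** * The cells and their Thom spaces *)

Section CellMap.
Variables (R : realType) (n d : nat) (w : 'I_n -> nat) (a : nat).
Hypothesis a_gt0 : (0 < a)%N.
Variable l : schubert_symbol d n.
Local Notation C := (Cplx R).
Local Notation frame := (frame R n d).
Local Notation cw := (minor_weight w a).
Local Notation lv := (schubert_val l).
Local Notation WGr := (WGr R d w a).
Local Notation U := (orbit_space (cell_action R w a l)).
Local Notation ccoord := (cell_coord w a l).
Implicit Types (A B : frame) (M : 'M[C]_(n, d)).

Let cw_gt0 (g : 'I_d -> 'I_n) : (0 < cw g)%N. Proof. exact: minor_weight_gt0. Qed.

Lemma orbit_eqP (u v : 'cV[C]_(schubert_length l)) :
  \pi_U u = \pi_U v <->
  exists2 z, z ^+ cw lv = 1 & v = cell_action_mx w l z *m u.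
Proof.
split=> [/eqmodP/asboolP[z [_ z1] ->]|[z z1 ->]]; first by exists z.
apply/eqmodP/asboolP; exists z => //; split=> //.
by apply/eqP => z0; move/eqP: z1; rewrite z0 expr0n eqn0Ngt cw_gt0 eq_sym oner_eq0.
Qed.

Lemma orbit_pi_open (v : 'cV[C]_(schubert_length l)) N :
  nbhs v N -> nbhs (\pi_U v) (\pi_U @` N).
Proof.
apply: quotient_pi_open => {N}u {}v /esym/orbit_eqP[z z1 ->].
exists (mulmx (cell_action_mx w l z)); split=> //.
  by apply: mulmx_continuous; [exact: cst_continuous|move=> ?; exact: cvg_id].
by move=> x; apply/esym/orbit_eqP; exists z.
Qed.

(** The chosen root need not vary continuously, but any other root gives the same orbit. The value
    is meaningful only where the minor at [l] is nonzero. *)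
Definition cell_map M : U := \pi_U (ccoord ((cw lv).-root (minor lv M)^-1) M).

Lemma root_minorK M : minor lv M != 0 ->
  (cw lv).-root (minor lv M)^-1 ^+ cw lv * minor lv M = 1.
Proof. by move=> M0; rewrite rootCK // mulVf. Qed.

(** Two normalizing factors differ by a root of unity, which acts through [cell_action_mx]. *)
Lemma cell_map_root M s : s ^+ cw lv * minor lv M = 1 -> cell_map M = \pi_U (ccoord s M).
Proof.
move=> sM; have M0 : minor lv M != 0.
  by apply/eqP => e; move/eqP: sM; rewrite e mulr0 eq_sym oner_eq0.
have rM := root_minorK M0; rewrite /cell_map; set r := _.-root _ in rM *.
have r0 : r != 0.
  by apply/eqP => e; move/eqP: rM; rewrite e expr0n eqn0Ngt cw_gt0 mul0r eq_sym oner_eq0.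
have z1 : (s / r) ^+ cw lv = 1.
  apply: (mulIf M0); rewrite mul1r expr_div_n mulrAC sM mul1r.
  by apply: (mulfI (expf_neq0 (cw lv) r0)); rewrite mulfV ?expf_neq0 // rM.
apply/orbit_eqP; exists (s / r) => //.
by rewrite -[in LHS](divfK r0 s) cell_coordM.
Qed.

(** If [s] normalizes [B] and [B] arises from [A] through [t], then [s * t] normalizes [A] and gives
    the same coordinates. *)
Lemma cell_map_wrel A B : wrel w a A B -> minor lv (\val A) != 0 ->
  cell_map (\val A) = cell_map (\val B).
Proof.
move=> AB A0; have B0 : minor lv (\val B) != 0 by rewrite -(minor_wrel _ AB).
have [t _ tB] := wrel_minor AB; rewrite [RHS]/cell_map.
set s := _.-root _; have sB : s ^+ cw lv * minor lv (\val B) = 1 by exact: root_minorK.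
rewrite (@cell_map_root _ (s * t)); last by rewrite exprMn -mulrA -tB.
by congr \pi_U; apply/colP => k; rewrite !mxE exprMn tB mulrA.
Qed.

Lemma cell_map_cell v : cell_map (cell_mx v) = \pi_U v.
Proof.
rewrite (@cell_map_root _ 1); last by rewrite expr1n mul1r minor1 // cell_mx_pivot.
by rewrite cell_coord_cell ?expr1n // cell_action_mx1 mul1mx.
Qed.

Lemma wrel_cell_map A v : in_closed_cell l (\val A) -> minor lv (\val A) != 0 ->
  \pi_U v = cell_map (\val A) -> wrel w a A (cell_frame v).
Proof.
move=> Al A0 /esym/orbit_eqP[z z1 ->]; rewrite -cell_coordM //.
by apply: wrel_cell => //; rewrite exprMn z1 mul1r root_minorK.
Qed.

Lemma cell_in_closed_cell (v : 'cV[C]_(schubert_length l)) :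
  in_closed_cell l (cell_mx v : 'M[C]_(n, d)).
Proof.
move=> m lm ml; apply/eqP; apply: contra_notT ml => /minor_cell_mx ml.
exact: schubert_le_anti.
Qed.

Lemma wrel_cell_frame u v : \pi_U u = \pi_U v ->
  wrel w a (cell_frame u) (cell_frame v).
Proof.
move=> uv; apply: wrel_cell_map; last by rewrite /= cell_map_cell.
- exact: cell_in_closed_cell.
- by rewrite /= minor1 ?oner_neq0 // cell_mx_pivot.
Qed.

Lemma cell_mx_continuous :
  continuous (@cell_mx R n d l).
Proof.
apply: mx_continuous => i j; under eq_fun do rewrite mxE.
apply: add_fun_continuous; first exact: cst_continuous.
apply: sum_continuous => k _; apply: mul_fun_continuous.
  exact: coord_continuous.
exact: cst_continuous.
Qed.

Lemma cell_coord_continuous :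
  continuous (fun p : C * 'M[C]_(n, d) => \pi_U (ccoord p.1 p.2)).
Proof.
move=> p; apply: (@continuous_comp _ _ _ (fun p : C * 'M[C]_(n, d) => ccoord p.1 p.2)).
  move: p; apply: mx_continuous => i j; under eq_fun do rewrite mxE.
  apply: mul_fun_continuous => [|p].
    by apply: exp_fun_continuous => p; exact: cvg_fst.
  by apply: (@continuous_comp _ _ _ snd); [exact: cvg_snd|exact: minor_continuous].
exact: pi_continuous.
Qed.

(** Near [M], [root_near] supplies a root [u] close to [s], and [cell_map_root] lets [u] replace the
    chosen root, which may jump. *)
Lemma cell_map_cvg M : minor lv M != 0 -> cell_map @ M --> cell_map M.
Proof.
move=> M0 N.
set s := (cw lv).-root (minor lv M)^-1; have sM := root_minorK M0; rewrite -/s in sM.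
move=> /(@cell_coord_continuous (s, M))[/= [S V] [Ss VM] SV].
have sE : s ^+ cw lv = (minor lv M)^-1 by rewrite rootCK.
have := root_near (cw_gt0 lv) Ss; rewrite sE => rS.
have cV : (minor lv M')^-1 @[M' --> M] --> (minor lv M)^-1.
  by apply: (@cvgV _ _ (nbhs M) _ (minor lv)) => //; exact: (@minor_continuous C n d lv M).
have near0 : \forall M' \near M, minor lv M' != 0.
  have := @minor_continuous C n d lv M [set x | x != 0]; apply.
  exact: nbhs_neq0.
have nearV : \forall M' \near M, V M' by [].
have nearS : \forall M' \near M, exists2 u, S u & u ^+ cw lv = (minor lv M')^-1.
  exact: cV _ rS.
suff : \forall M' \near M, N (cell_map M') by [].
apply: filterS3 nearS near0 nearV => M' [u Su uM'] M'0 VM'.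
rewrite (@cell_map_root M' u) ?uM' ?mulVf //.
exact: (SV (u, M')).
Qed.

(* The identity p_g(B)^c_l p_l(A)^c_g = p_g(A)^c_l between A and its
   normalization B fails near (B, M) as p_l(M) = 0 and p_g(M) <> 0. *)
Lemma cell_map_infty M g (K : set U) : minor g M != 0 -> minor lv M = 0 -> compact K ->
  \forall M' \near M, forall A, \val A = M' -> in_closed_cell l (\val A) ->
    minor lv (\val A) != 0 -> ~ K (cell_map (\val A)).
Proof.
move=> gM lM /compact_near_coveringP Kc.
pose f (v : 'cV[C]_(schubert_length l)) : C := minor g (cell_mx v) ^+ cw lv.
have fc : continuous f.
  apply: exp_fun_continuous => v.
  by apply: (@continuous_comp _ _ _ (@cell_mx R n d l));
    [exact: cell_mx_continuous|exact: minor_continuous].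
(* Along an orbit the minor at [g] changes by [t ^+ cw g] with [t ^+ cw lv = 1]; the power [cw lv]
   removes this factor, so [f] descends to [U]. *)
have fE u v : \pi_U u == \pi_U v -> f u == f v.
  move=> /eqP/wrel_cell_frame/wrel_minor[t _ tE]; rewrite /f.
  have t1 := tE lv; rewrite /= !(minor1 (cell_mx_pivot _)) mulr1 in t1.
  have /= -> := tE g; by rewrite exprMn -exprM mulnC exprM -t1 expr1n mul1r.
pose F : U -> C := f \o repr.
have Fc : continuous F by apply: repr_comp_continuous.
pose P M' u := F u * minor lv M' ^+ cw g - minor g M' ^+ cw lv != 0.
have Pc u : K u -> \near u & M, P M u.
  move=> _; have : continuous (fun p : U * 'M[C]_(n, d) =>
      F p.1 * minor lv p.2 ^+ cw g - minor g p.2 ^+ cw lv : C).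
    have mc h e : continuous (fun p : U * 'M[C]_(n, d) => minor h p.2 ^+ e : C).
      apply: exp_fun_continuous => p.
      by apply: (@continuous_comp _ _ _ snd); [exact: cvg_snd|exact: minor_continuous].
    move=> p; apply: cvgB; last exact: mc.
    apply: cvgM; last exact: mc.
    by apply: (@continuous_comp _ _ _ fst); [exact: cvg_fst|exact: Fc].
  move=> /(_ (u, M)) /(_ [set x | x != 0]); apply.
  apply: nbhs_neq0.
  by rewrite /= lM expr0n eqn0Ngt cw_gt0 mulr0 sub0r oppr_eq0 expf_neq0.
(* Compactness of [K] merges the neighbourhoods of [M] found for each [u] into one valid for all of
   [K]. *)
apply: filterS (Kc _ (nbhs M) P _ Pc) => M' KP A AM Al A0 KA.
have := KP _ KA; rewrite /P /= -AM.
rewrite subr_eq0 => /negP; apply; apply/eqP.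
have /wrel_minor[t t0 tE] : wrel w a A (cell_frame (repr (cell_map (\val A)))).
  by apply: wrel_cell_map => //; rewrite reprK.
have t1 := tE lv; rewrite /= (minor1 (cell_mx_pivot _)) in t1.
rewrite /F /f /=; have /= -> := tE g.
by rewrite exprMn -mulrA mulrCA -exprM mulnC exprM -exprMn -t1 expr1n mulr1.
Qed.

End CellMap.

(** * The torus action on a cell, transported to the orbit space *)

Section CellBundle.
Variables (R : realType) (n d : nat) (w : 'I_n -> nat) (a : nat).
Hypothesis a_gt0 : (0 < a)%N.
Variable l : schubert_symbol d n.
Local Notation C := (Cplx R).
Local Notation frame := (frame R n d).
Local Notation cw := (minor_weight w a).
Local Notation lv := (schubert_val l).
Local Notation WGr := (WGr R d w a).
Local Notation U := (orbit_space (cell_action R w a l)).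
Local Notation cmap := (cell_map w a l).
Implicit Types (A B : frame) (t : torus R n).

Definition cell_act t (u : U) : U := cmap (\val (scale_frame t (cell_frame (repr u)))).

Lemma cell_frame_minor (v : 'cV[C]_(schubert_length l)) :
  minor lv (\val (cell_frame v)) = 1.
Proof. by rewrite minor1 // cell_mx_pivot. Qed.

Lemma scale_wrel t A B : wrel w a A B -> wrel w a (scale_frame t A) (scale_frame t B).
Proof. by move=> /WGr_eqP AB; apply/WGr_eqP; rewrite -!WGr_actE AB. Qed.

Lemma scale_in_closed_cell t A :
  in_closed_cell l (\val A) -> in_closed_cell l (\val (scale_frame t A)).
Proof.
by move=> Al m lm ml; apply/eqP; rewrite scale_frame_minor_eq0; exact/eqP/Al.
Qed.

(** The echelon frame chosen by [cell_act] is equivalent to [A], and scaling by [t] respects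
    equivalence; so [cell_map] is equivariant. *)
Lemma cell_act_map t A : in_closed_cell l (\val A) -> minor lv (\val A) != 0 ->
  cell_act t (cmap (\val A)) = cmap (\val (scale_frame t A)).
Proof.
move=> Al A0; apply/esym/cell_map_wrel; rewrite ?scale_frame_minor_eq0 //.
by apply: scale_wrel; apply: wrel_cell_map => //; rewrite reprK.
Qed.

Lemma cell_act_pi t (v : 'cV[C]_(schubert_length l)) :
  cell_act t (\pi_U v) = cmap (\val (scale_frame t (cell_frame v))).
Proof.
rewrite -(@cell_act_map t (cell_frame v)); first by rewrite (cell_map_cell w a_gt0).
  exact: cell_in_closed_cell.
by rewrite cell_frame_minor oner_neq0.
Qed.

Lemma cell_act1 u : cell_act (torus_one R n) u = u.
Proof.
rewrite -[u]reprK cell_act_pi; apply: etrans (cell_map_cell w a_gt0 _); congr cell_map.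
rewrite /= (_ : diag_mx _ = 1%:M) ?mul1mx // -diag_const_mx; congr diag_mx.
Qed.

Lemma cell_actM s t u : cell_act (torus_mul s t) u = cell_act s (cell_act t u).
Proof.
rewrite -[u]reprK (cell_act_pi (torus_mul s t)) (cell_act_pi t) cell_act_map; first last.
- by rewrite scale_frame_minor_eq0 cell_frame_minor oner_neq0.
- exact/scale_in_closed_cell/cell_in_closed_cell.
congr cell_map; rewrite /= mulmxA mulmx_diag; congr (diag_mx _ *m _).
by apply/rowP => i; rewrite !mxE.
Qed.

Lemma torus_coord_continuous i : continuous (fun t : torus R n => \val t 0 i : C).
Proof.
move=> t; apply: (@continuous_comp _ _ _ (\val : torus R n -> 'rV[C]_n)
  (fun M : 'rV[C]_n => M 0 i)).
  exact: set_val_continuous.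
exact: coord_continuous.
Qed.

Lemma cell_act_continuous : continuous (fun p : torus R n * U => cell_act p.1 p.2).
Proof.
move=> [t u] N fN.
pose f (p : torus R n * 'cV[C]_(schubert_length l)) : 'M[C]_(n, d) :=
  diag_mx (\val p.1) *m cell_mx p.2.
have fc : continuous f.
  apply: mulmx_continuous => [|p].
    apply: mx_continuous => i j; under eq_fun do rewrite mxE -mulr_natr.
    apply: mul_fun_continuous => [p|]; last exact: cst_continuous.
    by apply: (@continuous_comp _ _ _ fst (fun t : torus R n => \val t 0 i));
      [exact: cvg_fst|exact: torus_coord_continuous].
  by apply: (@continuous_comp _ _ _ snd); [exact: cvg_snd|exact: cell_mx_continuous].
have M0 : minor lv (f (t, repr u)) != 0.
  by rewrite -[f _]/(\val (scale_frame t (cell_frame (repr u))))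
    scale_frame_minor_eq0 cell_frame_minor oner_neq0.
have fN' : nbhs (cmap (f (t, repr u))) N by exact: fN.
have nN : nbhs (f (t, repr u)) (cmap @^-1` N) by exact: cell_map_cvg fN'.
have cN : nbhs (t, repr u) (f @^-1` (cmap @^-1` N)) by exact: (fc (t, repr u) (cmap @^-1` N) nN).
case: cN => -[T V] [/= tT uV] TV.
(* Since [\pi_U] is open, the image of [V] is a neighbourhood of [u], and each point of this box
   lifts to [T] times [V]. *)
exists (T, \pi_U @` V); first split => //=.
  by rewrite -[u]reprK; exact: orbit_pi_open.
by move=> [t' _] [/= Tt' [v Vv <-]]; rewrite /= cell_act_pi; exact: (TV (t', v)).
Qed.

(** Scaling by [t] multiplies the minor at [g] by [tau g], so after renormalization by a root [s] of
    the inverse of [tau lv] each free entry is multiplied by a constant. *)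
Lemma cell_act_linear t : exists M : 'M[C]_(schubert_length l),
  forall v, cell_act t (\pi_U v) = \pi_U (M *m v).
Proof.
pose tau (g : 'I_d -> 'I_n) : C := \prod_k \val t 0 (g k).
pose s := (cw lv).-root (tau lv)^-1.
pose g (k : 'I_(schubert_length l)) : 'I_d -> 'I_n := upd lv (free_entry k).2 (free_entry k).1.
have tau0 : tau lv != 0 by apply/prodf_neq0 => k _; exact: torusP.
exists (diag_mx (\row_k (s ^+ cw (g k) * tau (g k)))) => v.
rewrite cell_act_pi (@cell_map_root _ _ _ _ _ a_gt0 _ _ s).
  congr \pi_U; apply/colP => k; rewrite mul_diag_mx !mxE scale_frame_minor -mulrA.
  by rewrite minor_upd ?cell_mx_pivot // cell_mx_free.
by rewrite scale_frame_minor cell_frame_minor mulr1 rootCK ?minor_weight_gt0 // mulVf.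
Qed.

Definition cell_bundle : orbibundle R n (schubert_weight w a l) (schubert_length l) :=
  @Orbibundle R n (schubert_weight w a l) (schubert_length l) (cell_action R w a l)
    cell_act cell_act1 cell_actM cell_act_continuous cell_act_linear.

End CellBundle.

(** * Collapsing the boundary of a cell gives its Thom space *)

Section CellThom.
Variables (R : realType) (n d : nat) (w : 'I_n -> nat) (a : nat).
Hypothesis a_gt0 : (0 < a)%N.
Variable l : schubert_symbol d n.
Local Notation C := (Cplx R).
Local Notation frame := (frame R n d).
Local Notation lv := (schubert_val l).
Local Notation WGr := (WGr R d w a).
Local Notation U := (orbit_space (cell_action R w a l)).
Local Notation cmap := (cell_map w a l).
Local Notation xi := (cell_bundle R w a_gt0 l).
Implicit Types (A B : frame) (t : torus R n).

(** [Y] stands for the stratum [X_j], and its intersection with [Z] for [X_(j-1)]. A point of this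
    intersection is the preimage of infinity: collapsing an empty set would produce none. *)
Variable Y : set WGr.
Hypothesis Y_closed : closed Y.
Hypothesis Y_closed_cell : forall A, Y (\pi_WGr A) -> in_closed_cell l (\val A).
Hypothesis Y_cell : forall v : 'cV[C]_(schubert_length l), Y (\pi_WGr (cell_frame v)).

Let Z : set WGr := [set x | minor lv (\val (repr x)) = 0].

Hypothesis YZ_neq0 : exists2 z, Y z & Z z.

Definition thom_map (x : WGr) : one_point_compactification U :=
  if minor lv (\val (repr x)) == 0 then None else Some (cmap (\val (repr x))).

Lemma thom_map_pi A : thom_map (\pi_WGr A) =
  if minor lv (\val A) == 0 then None else Some (cmap (\val A)).
Proof.
have AB := wrel_repr w a A; rewrite /thom_map -(minor_wrel _ AB).
case: (minor lv (\val A) =P 0) => [_|/eqP A0]; first by [].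
exact: (congr1 Some (esym (cell_map_wrel a_gt0 AB A0))).
Qed.

Lemma thom_map_act t x : Y x ->
  thom_map (WGr_act t x) = omap (@cell_act _ _ _ w a l t) (thom_map x).
Proof.
have [A ->] := WGr_surj x => /Y_closed_cell Al; rewrite WGr_actE !thom_map_pi.
rewrite scale_frame_minor_eq0.
case: (minor lv (\val A) =P 0) => [_|/eqP A0]; first by [].
exact: (congr1 Some (esym (cell_act_map w a_gt0 t Al A0))).
Qed.

Lemma thom_map_within : {within Y, continuous thom_map}.
Proof.
apply/subspace_continuousP => x; have [A ->] := WGr_surj x => YA N.
rewrite /from_subspace thom_map_pi => fN.
(* As [\pi_WGr] is open, it suffices to work with frames near [A]. *)
suff NA : \forall B \near A, Y (\pi_WGr B) -> N (thom_map (\pi_WGr B)).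
  have : nbhs (\pi_WGr A) [set y | Y y -> N (thom_map y)].
    by apply: filterS (WGr_pi_open w a NA) => _ [B BN <-].
  by [].
case: (minor lv (\val A) =P 0) fN => [A0|/eqP A0] fN.
  (* [A] lies on the boundary: a neighbourhood of infinity contains the complement of a compact [K],
     and [cell_map] avoids [K] near [A]. *)
  case: fN => K [Kc _] KN; have [g gA] := minor_ex (frameP A).
  have nK : \forall B \near A, forall A', \val A' = \val B -> in_closed_cell l (\val A') ->
      minor lv (\val A') != 0 -> ~ K (cmap (\val A')).
    exact: frame_val_near (cell_map_infty a_gt0 gA A0 Kc).
  apply: filterS nK => B BK YB; rewrite thom_map_pi.
  case: (minor lv (\val B) =P 0) => [_|/eqP B0].
    by apply: KN; right.
  apply: KN; left; exists (cmap (\val B)) => //.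
  by apply: BK => //; exact: Y_closed_cell.
have cN : nbhs (\val A) (cmap @^-1` (Some @^-1` N)) by exact: cell_map_cvg fN.
have {}cN : \forall B \near A, (Some @^-1` N) (cmap (\val B)).
  exact: frame_val_near cN.
have nz : nbhs (\val A) [set M | minor lv M != 0].
  exact: @minor_continuous C n d lv _ _ (nbhs_neq0 A0).
have {}nz : \forall B \near A, minor lv (\val B) != 0.
  exact: frame_val_near nz.
apply: filterS2 nz cN => B /negPf B0 NB _.
by rewrite thom_map_pi B0.
Qed.

Let Q := collapse ([set x | Z (\val x)] : set (set_type Y)).

Let setY (x : set_type Y) : Y (\val x). Proof. exact: set_valP. Qed.

Lemma thom_map_Z x : Z x -> thom_map x = None.
Proof. by rewrite /thom_map => /eqP ->. Qed.

Lemma collapse_eqP (x y : set_type Y) :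
  \pi_Q x = \pi_Q y <-> x = y \/ Z (\val x) /\ Z (\val y).
Proof.
split=> [/eqmodP/orP[/eqP|/andP[/set_mem ? /set_mem ?]]|H]; [by left|by right|].
apply/eqmodP/orP; case: H => [->|[Zx Zy]]; first by left.
by right; apply/andP; split; exact/mem_set.
Qed.

Definition collapse_thom (q : Q) : thom xi := thom_map (\val (repr q)).

Lemma collapse_thomE x : collapse_thom (\pi_Q x) = thom_map (\val x).
Proof.
rewrite /collapse_thom; have : \pi_Q (repr (\pi_Q x)) = \pi_Q x by rewrite reprK.
by case/collapse_eqP => [-> //|[Zx Zy]]; rewrite !thom_map_Z.
Qed.

Lemma collapse_thom_continuous : continuous collapse_thom.
Proof.
apply/quotient_continuous => x N /=; rewrite collapse_thomE => fN.
have fY : \forall y \near \val x, Y y -> N (thom_map y).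
  by have /subspace_continuousP/(_ _ (setY x) _ fN) := thom_map_within.
apply: filterS (set_val_near fY) => y /= yN.
by rewrite collapse_thomE; exact: yN (setY y).
Qed.

Definition cell_incl (v : 'cV[C]_(schubert_length l)) : set_type Y :=
  exist (fun x => x \in Y) (\pi_WGr (cell_frame v)) (mem_set (Y_cell v)).

Lemma cell_incl_eq u v : \pi_U u = \pi_U v -> cell_incl u = cell_incl v.
Proof.
by move=> /(wrel_cell_frame a_gt0) uv; apply/val_inj/WGr_eqP.
Qed.

Lemma thom_map_cell v : thom_map (\val (cell_incl v)) = Some (\pi_U v).
Proof.
by rewrite thom_map_pi cell_frame_minor oner_eq0 /= cell_map_cell.
Qed.

Lemma cell_incl_continuous : continuous cell_incl.
Proof.
apply: set_type_continuous => v.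
apply: (@continuous_comp _ _ _ (fun v => cell_frame v : frame) \pi_WGr).
  by apply: mk_frame_continuous; exact: cell_mx_continuous.
exact: pi_continuous.
Qed.

Definition thom_collapse (z0 : Q) (p : thom xi) : Q :=
  if p is Some u then \pi_Q (cell_incl (repr u)) else z0.

(** At infinity, for [V] an open neighbourhood of [z0], the points of [Y] sent outside [V] form a
    compact set missing [Z]; [cell_map] carries it onto a compact set containing all [u] that are
    sent outside [V]. *)
Lemma thom_collapse_continuous z0 : (exists2 x, z0 = \pi_Q x & Z (\val x)) ->
  continuous (thom_collapse z0).
Proof.
move=> [x0 z0E Zx0].
have gc : continuous (fun u : U => \pi_Q (cell_incl (repr u)) : Q).
  apply/quotient_continuous.
  have -> : (fun u : U => \pi_Q (cell_incl (repr u)) : Q) \o \pi_U =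
      \pi_Q \o cell_incl.
    by apply/funext => v /=; congr \pi_Q; apply: cell_incl_eq; rewrite reprK.
  move=> v; apply: continuous_comp; first exact: cell_incl_continuous.
  exact: pi_continuous.
case=> [u|] N; first exact: gc.
move=> zN; have : nbhs z0 N by exact: zN.
rewrite nbhsE => -[V [oV Vz0] VN] {zN}.
have [W oW WV] : open (\pi_Q @^-1` V : set (set_type Y)) by [].
have DE : Y `&` ~` W = [set \val x | x in [set x | ~ V (\pi_Q x)]].
  apply/seteqP; split=> [x [Yx nWx]|_ [x nVx <-]].
    exists (exist (fun x => x \in Y) x (mem_set Yx)) => // Vx; apply: nWx.
    by have : (\val @^-1` W) (exist (fun x => x \in Y) x (mem_set Yx)) by rewrite WV.
  by split; [exact: setY|move=> Wx; apply: nVx; rewrite -[V _]/((\pi_Q @^-1` V) x) -WV].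
pose D := Y `&` ~` W.
have Dc : closed D by apply: closedI => //; exact: open_closedC.
have Dk : compact D.
  by apply: subclosed_compact Dc (WGr_compact a_gt0) _.
(* A point of [Z] would collapse to [z0], which lies in [V]. *)
have Dn x : D x -> minor lv (\val (repr x)) != 0.
  rewrite /D DE => -[y nVy <-]; apply/eqP => Zy; apply: nVy.
  by suff -> : \pi_Q y = z0 by []; rewrite z0E; apply/collapse_eqP; right.
(* On [D] the map [thom_map] is [Some] of [cell_map], so continuity is inherited from
   [thom_map_within], [Some] being open. *)
have hc : {within D, continuous (fun x => cmap (\val (repr x)))}.
  apply/subspace_continuousP => x Dx M cM.
  have [Yx _] := Dx.
  have xE y : D y -> thom_map y = Some (cmap (\val (repr y))).
    by move=> /Dn /negPf y0; rewrite /thom_map y0.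
  have fM : nbhs (thom_map x) (Some @` M).
    by rewrite xE //; exact: one_point_compactification_some_nbhs.
  have nM : \forall y \near x, Y y -> (Some @` M) (thom_map y).
    by have /subspace_continuousP/(_ _ Yx _ fM) := thom_map_within.
  apply: filterS nM => y yM Dy; have [Yy _] := Dy.
  have [u Mu] := yM Yy; rewrite xE // => -[e].
  by suff : M (cmap (\val (repr y))) by []; rewrite -e.
pose K := [set u : U | ~ V (\pi_Q (cell_incl (repr u)))].
exists K; last first.
  move=> _ [[u /= nK <-]|->]; apply: VN => //=.
  by apply: contrapT => nV; apply: nK.
(* [K] is the preimage of a closed set under the continuous map [gc]; closed in the compact image of
   [D], it is compact. *)
have Kcl : closed K.
  rewrite (_ : K = ~` ((fun u : U => \pi_Q (cell_incl (repr u)) : Q) @^-1` V)) //.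
  by apply: open_closedC; move/continuousP: gc; apply.
split=> //; apply: subclosed_compact Kcl (continuous_compact hc Dk) _ => u Ku.
exists (\val (cell_incl (repr u))); first by rewrite /D DE; exists (cell_incl (repr u)).
have := thom_map_cell (repr u); rewrite /thom_map reprK.
by case: ifP => // _ [].
Qed.

Lemma collapse_thom_homeo : homeomorphism collapse_thom.
Proof.
split; first exact: collapse_thom_continuous.
have [z0 Yz0 Zz0] := YZ_neq0.
pose y0 : set_type Y := exist (fun x => x \in Y) z0 (mem_set Yz0).
exists (thom_collapse (\pi_Q y0)); split.
- by apply: thom_collapse_continuous; exists y0.
- move=> q; rewrite -[q]reprK collapse_thomE; set x := repr q.
  rewrite /thom_map; case: (minor lv (\val (repr (\val x))) =P 0) => [Zx|/eqP x0] /=.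
    by apply/collapse_eqP; right.
  congr \pi_Q; apply/val_inj; rewrite /= -[RHS]reprK; apply/esym/WGr_eqP.
  apply: wrel_cell_map; rewrite ?reprK //.
  by apply: Y_closed_cell; rewrite reprK; exact: setY.
- case=> [u|] /=; rewrite collapse_thomE; last exact: thom_map_Z.
  by rewrite thom_map_cell reprK.
Qed.

(** Stated for any [A] with the same points as [Z], so that the preceding stratum can be
    substituted. *)
Lemma collapse_cell_thom (A : set (set_type Y)) :
  (forall x, A x <-> Z (\val x)) ->
  exists (xi : orbibundle R n (schubert_weight w a l) (schubert_length l))
         (f : collapse A -> thom xi),
    [/\ homeomorphism f,
        forall x, A x -> f (\pi_(collapse A) x) = None,
        exists2 x : set_type Y, \val x = schubert_point R w a l
          & f (\pi_(collapse A) x) = Some (zero_section xi)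
      & forall t (x y : set_type Y), \val y = WGr_act t (\val x) ->
          f (\pi_(collapse A) y) = thom_act t (f (\pi_(collapse A) x))].
Proof.
move=> AZ; have -> : A = [set x | Z (\val x)] by apply/seteqP; split=> x /AZ.
exists xi, collapse_thom; split.
- exact: collapse_thom_homeo.
- by move=> x Zx; rewrite collapse_thomE; exact: thom_map_Z.
- exists (cell_incl 0); last by rewrite collapse_thomE; exact: thom_map_cell.
  by rewrite /=; congr \pi_WGr; apply: val_inj; rewrite /= cell_mx0.
- move=> t x y yx; rewrite !collapse_thomE yx; apply: thom_map_act; exact: setY.
Qed.

End CellThom.

(** * The stratification *)

Section Stratification.
Variables (R : realType) (n d : nat) (w : 'I_n -> nat) (a N : nat).
Hypothesis a_gt0 : (0 < a)%N.
Variable lam : 'I_N.+1 -> schubert_symbol d n.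
Hypothesis lam_bij : bijective lam.
Hypothesis lam_mono : forall i j, schubert_le (lam i) (lam j) -> (i <= j)%N.
Local Notation C := (Cplx R).
Local Notation frame := (frame R n d).
Local Notation WGr := (WGr R d w a).
Implicit Types (A B : frame) (i j k : 'I_N.+1).

Definition stratum i : set WGr :=
  minor_locus [set g | exists2 k : 'I_N.+1, (i < k)%N & g = schubert_val (lam k)].

Lemma stratumE i A : stratum i (\pi_WGr A) <->
  forall k : 'I_N.+1, (i < k)%N -> minor (schubert_val (lam k)) (\val A) = 0.
Proof.
rewrite /stratum minor_locusE; split=> [H k ik|H _ [k ik ->]]; last exact: H.
by apply: H; exists k.
Qed.

(** Symbols strictly above [lam i] come later in the total order, so their minors vanish on the
    stratum. *)
Lemma stratum_closed_cell i A :
  stratum i (\pi_WGr A) -> in_closed_cell (lam i) (\val A).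
Proof.
move=> /stratumE Ai m; have [lamV _ lamK] := lam_bij; rewrite -(lamK m).
move=> /lam_mono le ne; apply: Ai; rewrite ltn_neqAle le andbT.
by apply/eqP => /val_inj e; apply: ne; rewrite -e.
Qed.

Lemma cell_stratum i j (v : 'cV[C]_(schubert_length (lam i))) :
  (i <= j)%N -> stratum j (\pi_WGr (cell_frame v)).
Proof.
move=> ij; apply/stratumE => k jk; apply/eqP; apply: contraLR jk => /minor_cell_mx.
by rewrite -leqNgt => /lam_mono /leq_trans; apply.
Qed.

Lemma stratum_succ i j x : j = i.+1 :> nat ->
  stratum i x <-> stratum j x /\ minor (schubert_val (lam j)) (\val (repr x)) = 0.
Proof.
move=> ji; rewrite -[x in stratum _ x]reprK -[x in stratum j x]reprK !stratumE.
split=> [H|[H Hj] k]; first by split=> [k jk|]; apply: H; rewrite ?ji // -ji ltnW.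
rewrite leq_eqVlt -ji => /orP[/eqP/val_inj<- //|]; exact: H.
Qed.

Lemma symbol_minor_ex A :
  exists m : schubert_symbol d n, minor (schubert_val m) (\val A) != 0.
Proof.
have [g gA] := minor_ex (frameP A); have [m [s ms]] := sort_inj (minor_neq0_inj gA).
exists m; rewrite (_ : minor _ _ = minor (g \o s) (\val A)).
  by rewrite minor_perm mulf_neq0 ?signr_eq0.
by congr (\det _); apply/matrixP => i j; rewrite !mxE ms.
Qed.

Lemma symbol_val_ge (m : schubert_symbol d n) (j : 'I_d) : (j <= schubert_val m j)%N.
Proof.
case: j => j; elim: j => [//|j IH] jd.
apply: leq_ltn_trans (IH (ltnW jd)) _; exact: schubert_lt.
Qed.

(** The symbol of the first [d] rows lies below every other, so the order must put it first. *)
Lemma lam0_val (d_le_n : (d <= n)%N) (j : 'I_d) : schubert_val (lam ord0) j = j :> nat.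
Proof.
have pf : [forall i : 'I_d, forall j : 'I_d, (i < j)%N ==>
    ([ffun k => widen_ord d_le_n k] i < [ffun k => widen_ord d_le_n k] j)%N].
  by apply/forallP => i; apply/forallP => k; apply/implyP; rewrite !ffunE.
pose m : schubert_symbol d n := exist _ [ffun k => widen_ord d_le_n k] pf.
have mE (k : 'I_d) : schubert_val m k = k :> nat by rewrite /schubert_val /= ffunE.
have [lamV _ lamK] := lam_bij.
have : (lamV m <= @ord0 N)%N.
  by apply: lam_mono => k; rewrite lamK mE; exact: symbol_val_ge.
rewrite leqn0 => /eqP m0; have -> : ord0 = lamV m by exact/val_inj/esym.
by rewrite lamK mE.
Qed.

Lemma stratum0 : (d <= n)%N -> stratum ord0 = [set schubert_point R w a (lam ord0)].
Proof.
(* The first cell is a point: a free entry would lie in one of the first [d] rows, all of which are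
   pivot rows. *)
move=> dn; have cell0 (v : 'cV[C]_(schubert_length (lam ord0))) : v = 0.
  apply/colP => k; have [lt /codomP nc] := free_entryP k; case: nc.
  have {}lt : ((free_entry k).1 < (free_entry k).2)%N by rewrite -(lam0_val dn).
  exists (Ordinal (ltn_trans lt (ltn_ord _))); apply/val_inj/esym; exact: lam0_val.
have ptE : schubert_point R w a (lam ord0) =
    \pi_WGr (cell_frame (0 : 'cV[C]_(schubert_length (lam ord0)))).
  by congr \pi_WGr; apply: val_inj; rewrite /= cell_mx0.
apply/seteqP; split=> [x|_ ->]; last by rewrite ptE; exact: cell_stratum.
have [A ->] := WGr_surj x => A0; rewrite /= ptE; apply/WGr_eqP.
apply: (wrel_cell_map a_gt0); first exact: stratum_closed_cell.
  (* Some minor on a symbol is nonzero, and on this stratum only the one at [lam ord0] can be. *)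
  have [m mA] := symbol_minor_ex A; have [lamV _ lamK] := lam_bij.
  have /stratumE H := A0; have [k0|k0] := posnP (lamV m).
    by rewrite (_ : ord0 = lamV m) ?lamK //; exact/val_inj/esym.
  by move: mA; rewrite -(lamK m) H // eqxx.
by rewrite -[RHS]reprK; congr \pi__; rewrite [RHS]cell0.
Qed.

End Stratification.

Theorem proposition4p1 (R : realType) (n d : nat)
    (d_gt0 : (0 < d)%N) (d_lt_n : (d < n)%N)
    (w : 'I_n -> nat) (a : nat) (a_gt0 : (0 < a)%N)
    (lam : 'I_('C(n, d).-1.+1) -> schubert_symbol d n)
    (lam_bij : bijective lam)
    (lam_mono : forall i j, schubert_le (lam i) (lam j) -> (i <= j)%N) :
  exists X : 'I_('C(n, d).-1.+1) -> set (WGr R d w a),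
    [/\ forall i, closed (X i),
        forall i (t : torus R n) x, X i x -> X i (WGr_act t x),
        exists pt, X ord0 = [set pt],
        X ord_max = setT
      & forall i j : 'I_('C(n, d).-1.+1), j = i.+1 :> nat ->
          X i `<=` X j /\
          let XjXi := collapse ([set x | X i (\val x)] : set (set_type (X j))) in
          exists (xi : orbibundle R n (schubert_weight w a (lam j))
                                      (schubert_length (lam j)))
                 (f : XjXi -> thom xi),
            [/\ homeomorphism f,
                forall x : set_type (X j), X i (\val x) -> f (\pi_XjXi x) = None,
                exists2 x : set_type (X j), \val x = schubert_point R w a (lam j)
                  & f (\pi_XjXi x) = Some (zero_section xi)
              & forall (t : torus R n) (x y : set_type (X j)),
                  \val y = WGr_act t (\val x) ->
                  f (\pi_XjXi y) = thom_act t (f (\pi_XjXi x))]].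
Proof.
exists (@stratum R n d w a _ lam); split.
- by move=> i; exact: minor_locus_closed.
- by move=> i t x; exact: minor_locus_act.
- by exists (schubert_point R w a (lam ord0)); exact/stratum0/ltnW.
(* No index exceeds the last one, so the top stratum carries no condition. *)
- apply/seteqP; split=> // x _; have [A ->] := WGr_surj x; apply/stratumE => // k.
  by rewrite ltnNge leq_ord.
move=> i j ji; have XiE x := @stratum_succ R n d w a _ lam i j x ji; split=> [x /XiE[] //|].
apply: collapse_cell_thom => //.
- exact: minor_locus_closed.
- by move=> A; exact: stratum_closed_cell.
- by move=> v; exact: cell_stratum.
- have ij : (i <= j)%N by rewrite ji.
  (* The centre of the preceding cell shows that the set to be collapsed is nonempty. *)
  pose z : WGr R d w a := \pi_(WGr R d w a) (cell_frame (0 : 'cV_(schubert_length (lam i)))).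
  have /XiE[] : stratum lam i z by exact: cell_stratum.
  by exists z.
- move=> x /=; split=> [/XiE[] //|x0]; apply/XiE; split=> //; exact: set_valP.
Qed.
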